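(* Let $\mu=\mu_{\mathrm{at}}+\mu_{\mathrm{ac}}+\mu_{\mathrm{sc}}$ be a finite positive Borel measure supported on $[0,1]$, where $\mu_{\mathrm{at}}$ is atomic, $d\mu_{\mathrm{ac}}=\rho\,d\theta$ is absolutely continuous with respect to Lebesgue measure with density $\rho$, and $\mu_{\mathrm{sc}}$ is singular continuous. Let $m_k=\int_{[0,1]}e^{i2\pi\theta k}\,d\mu(\theta)$ be its Fourier coefficients, and for each $N\in\mathbb{N}$ let $\tilde K_N$ be the modified Christoffel–Darboux kernel built from $(m_k)_{k=0}^N$. Then for Lebesgue almost all $\theta\in[0,1]$ $$\lim_{N\to\infty}\Big[\frac{N+1}{\tilde K_N(e^{i2\pi\theta},e^{i2\pi\theta})}-1\Big]=\rho(\theta).$$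
   Context: Modified Christoffel–Darboux kernel: given $(m_k)_{k=0}^N$, set $\tilde m_0=m_0+1$, $\tilde m_k=m_k$ for $k>0$, and $\tilde m_{-k}=\overline{\tilde m_k}$. (These are the Fourier coefficients of $d\mu+1\,d\theta$.) Let $\tilde{\mathbf{M}}_N$ be the $(N+1)\times(N+1)$ Hermitian Toeplitz matrix with entries $(\tilde{\mathbf{M}}_N)_{j,l}=\tilde m_{j-l}$, $0\le j,l\le N$; it is positive definite, hence invertible. With $\psi_N(z)=[1,z,z^2,\ldots,z^N]^\top$ and $^H$ denoting the Hermitian transpose, $\tilde K_N(z,s)=\psi_N(s)^H\tilde{\mathbf{M}}_N^{-1}\psi_N(z)$ for $z,s\in\mathbb{C}$. *)

(* Defs.v *)
From HB Require Import structures.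
From mathcomp Require Import all_boot all_order all_algebra.
From mathcomp Require Import complex.
From mathcomp Require Import all_classical all_reals all_analysis.

Set Implicit Arguments.
Unset Strict Implicit.
Unset Printing Implicit Defensive.

Import Order.TTheory GRing.Theory Num.Theory.
Import numFieldNormedType.Exports.

Local Open Scope classical_set_scope.
Local Open Scope ring_scope.
Local Open Scope complex_scope.

Definition expi {R : realType} (t : R) : R[i] := cos t +i* sin t.

(* There is no integral of complex-valued functions in the library; the real
   and imaginary parts are integrated separately. *)
Definition Cintegral (d : measure_display) (T : measurableType d) (R : realType)
    (mu : {measure set T -> \bar R}) (D : set T) (f : T -> R[i]) : R[i] :=
  (\int[mu]_(x in D) complex.Re (f x)) +i* (\int[mu]_(x in D) complex.Im (f x)).

Definition fourier_coef {R : realType}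
    (mu : {measure set (measurableTypeR R) -> \bar R}) (k : nat) : R[i] :=
  Cintegral mu `[0, 1] (fun t : R => expi (2 * pi * t * k%:R)).

(* On R, a finite measure is a countable sum of weighted Dirac masses iff it is
   carried by a countable set. *)
Definition atomic {R : realType} (mu : {measure set (measurableTypeR R) -> \bar R}) :=
  exists2 A : set R, countable A & mu (~` A) = 0%E.

Definition singular_continuous {R : realType}
    (mu : {measure set (measurableTypeR R) -> \bar R}) :=
  (forall x : R, mu [set x] = 0%E) /\
  exists A : set (measurableTypeR R),
    [/\ measurable A, @lebesgue_measure R A = 0%E & mu (~` A) = 0%E].

(* [rho] is only relevant on [0, 1]. *)
Definition has_density01 {R : realType}
    (mu : {measure set (measurableTypeR R) -> \bar R}) (rho : R -> R) :=
  (@lebesgue_measure R).-integrable `[0, 1] (EFin \o rho) /\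
  forall D : set (measurableTypeR R), measurable D ->
    mu D = (\int[@lebesgue_measure R]_(x in D `&` `[0%R, 1%R]) (rho x)%:E)%E.

(* [Negz n] is the integer - n.+1. *)
Definition modified_coef {R : realType} (m : nat -> R[i]) (k : int) : R[i] :=
  match k with
  | Posz n => if n == 0%N then m 0%N + 1 else m n
  | Negz n => conjc (m n.+1)
  end.

Definition modified_toeplitz {R : realType} (m : nat -> R[i]) (N : nat) :
    'M[R[i]]_N.+1 :=
  \matrix_(j < N.+1, l < N.+1) modified_coef m (j%:Z - l%:Z).

Definition monomials {R : realType} (N : nat) (z : R[i]) : 'cV[R[i]]_N.+1 :=
  \col_(j < N.+1) z ^+ j.

(* The product is a 1 x 1 matrix, of which we take the only entry. *)
Definition modified_kernel {R : realType} (m : nat -> R[i]) (N : nat)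
    (z s : R[i]) : R[i] :=
  ((map_mx conjc (monomials N s))^T
     *m invmx (modified_toeplitz m N) *m monomials N z) 0 0.

(* Main.v *)
Require Import Defs.
From HB Require Import structures.
From mathcomp Require Import all_boot all_order all_algebra.
From mathcomp Require Import complex.
From mathcomp Require Import all_classical all_reals all_analysis.
From mathcomp Require Import measurable_realfun lra ring.

(* Let n = N + 1 and let F_N be the Fejer kernel, so that
   |sum_(l < n) conj(z)^l e^(2 i pi l t)|^2 = n F_N(t - theta) for
   z = e^(2 i pi theta). The modified measure mu + dtheta has density
   w = 1 + rho >= 1, and n / K_N(z, z) lies between a harmonic and an arithmetic
   Fejer mean:
     1 / int F_N(t - theta) / w(t) dt <= n / K_N(z, z) <= 1 + int F_N(t - theta) dmu(t).
   The upper bound is Cauchy-Schwarz for the Toeplitz form (that is, testing the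
   Christoffel function on the normalized Dirichlet kernel). For the lower bound
   the singular part of mu is dropped and Cauchy-Schwarz is used with the weight
   w. Since 1 / w is a 1-Lipschitz function of rho, both bounds tend to w(theta)
   at every Lebesgue point theta of rho where the singular parts of mu have zero
   derivative, hence almost everywhere. *)

Set Implicit Arguments.
Unset Strict Implicit.
Unset Printing Implicit Defensive.

Import Order.TTheory GRing.Theory Num.Theory.
Import numFieldNormedType.Exports.

Local Open Scope classical_set_scope.
Local Open Scope ring_scope.
Local Open Scope complex_scope.

(** * Differentiation of singular measures *)

(** The Lebesgue measure added to mu does double duty: it makes the Toeplitz form dominate the
    Euclidean norm of the coefficients, so the matrix is invertible for every mu, and it keeps 1 / w
    bounded even where rho vanishes. A total mass 1 does not suffice for convergence at a Lebesgue
    point; what is used is the pointwise majorant F_N(t - theta) <= C min(n, 1 / (n (t - theta)^2)),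
    summed over dyadic shells. By periodicity the peak at theta = 0 reappears at t = 1, and
    conversely, so the majorant fails at both endpoints and these are discarded. The atomic and the
    singular continuous parts enter in the same way, as finite measures carried by Lebesgue-null
    sets. The density rho is given only through integrals over [0, 1]; it is traded for a
    Radon-Nikodym derivative h that is nonnegative everywhere, integrable on the line and almost
    everywhere equal to rho on [0, 1]. *)

(** Good-sets argument: the sets squeezed between a closed and an open set up to arbitrarily small
    [nu]-mass form a sigma-algebra that contains the half-lines [[a, +oo[]. *)
Lemma finite_measure_regular (R : realType)
    (nu : {measure set (measurableTypeR R) -> \bar R}) (D : set R) (e : R) :
  (nu setT < +oo)%E -> (measurable : set (set (measurableTypeR R))) D -> 0 < e ->
  exists C U : set R,
    [/\ closed C, open U, C `<=` D, D `<=` U & (nu (U `\` C) < e%:E)%E].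
Proof.
move=> nufin mD; move: e.
pose M := [set A : set (measurableTypeR R) |
  forall e : R, 0 < e -> exists C U : set R,
    [/\ closed C, open U, C `<=` A, A `<=` U & (nu (U `\` C) < e%:E)%E]].
(* Continuity from above, where finiteness of [nu] enters. It serves to shrink the open half-line
   around [[a, +oo[] and to cut a countable union of closed sets down to a finite one. *)
have cvg_small (F : (set (measurableTypeR R))^nat) (e : R) :
    (forall i, measurable (F i)) -> nonincreasing_seq F ->
    (nu (\bigcap_n F n) < e%:E)%E -> exists n, (nu (F n) < e%:E)%E.
  move=> mF nF nue.
  have F0 : (nu (F 0%N) < +oo)%E.
    by rewrite (le_lt_trans _ nufin)// le_measure// inE.
  have := nonincreasing_cvg_mu F0 mF (bigcapT_measurable mF) nF.
  have [r nur] : exists r, nu (\bigcap_n F n) = r%:E.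
    exists (fine (nu (\bigcap_n F n))); rewrite fineK// ge0_fin_numE//.
    exact: lt_trans nue (ltry _).
  rewrite nur => /(_ [set y | y < e%:E]%E).
  case=> [|n _ /(_ n (leqnn n)) /=]; last by exists n.
  by apply: open_nbhs_nbhs; split; [exact: open_ereal_lt_ereal|rewrite -nur].
suff : M D by [].
have {mD} : (@RGenCInfty.G R).-sigma.-measurable D.
  by rewrite -RGenCInfty.measurableE.
move: D.
apply: smallest_sub => [|A [a ->] e e0]; last first.
  pose F (n : nat) : set (measurableTypeR R) := `]a - n.+1%:R^-1, a[%classic.
  have [|||n nuF] := cvg_small F e.
  - by move=> n; exact: measurable_itv.
  - move=> m n mn; apply/subsetPset => x; rewrite /F/= !in_itv/= => /andP[ax ->].
    rewrite andbT (le_lt_trans _ ax)// lerB// lef_pV2 ?posrE//.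
    by rewrite ler_nat.
  - rewrite (_ : \bigcap_n F n = set0) ?measure0 ?lte_fin//.
    rewrite -subset0 => x Fx; have := Fx 0%N I; rewrite /F/= in_itv/= => /andP[_ xa].
    have [k] := @ltr_add_invr R x a xa.
    have := Fx k I; rewrite /F/= in_itv/= => /andP[ak _].
    by rewrite -ltrBrDr => xk; have := lt_trans ak xk; rewrite ltxx.
  exists `[a, +oo[%classic, `]a - n.+1%:R^-1, +oo[%classic; split => //.
  - exact: interval_closed.
  - move=> x/=; rewrite !in_itv/= !andbT; apply: lt_le_trans.
    by rewrite ltrBlDr ltrDl invr_gt0.
  - apply: le_lt_trans nuF; rewrite le_measure ?inE//.
    + by apply: measurableD; exact: measurable_itv.
    + exact: measurable_itv.
    + by move=> x /=; rewrite /F/= !in_itv/= !andbT => -[-> /negP]; rewrite -ltNge.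
split.
- move=> e e0; exists set0, set0; split => //; first exact: closed0.
  by rewrite setD0 measure0 lte_fin.
- move=> A MA e e0; have [C [U [cC oU CA AU nue]]] := MA e e0.
  exists (~` U), (~` C); split.
  + exact: open_closedC.
  + exact: closed_openC.
  + by rewrite setTD; exact: subsetC.
  + by rewrite setTD; exact: subsetC.
  + by rewrite setDE setCK setIC -setDE.
- move=> A MA e e0.
  (* The errors add up to [e / 2], which leaves room for the strict inequality. Only finitely many
     [C k] will be kept, since a countable union of closed sets need not be closed. *)
  have e2 n : 0 < (e / 2) / (2 ^ n.+1)%:R :> R by rewrite !divr_gt0// ltr0n expn_gt0.
  have /choice[C] := fun n => MA n _ (e2 n).
  move=> /choice[U] CU.
  have mC n : measurable (C n : set (measurableTypeR R)).
    by apply: closed_measurable; have [] := CU n.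
  have mU n : measurable (U n : set (measurableTypeR R)).
    by apply: open_measurable; have [] := CU n.
  pose F n : set (measurableTypeR R) := (\bigcup_k U k) `\` \bigcup_(k in `I_n) C k.
  have [|||n nuF] := cvg_small F e.
  - move=> n; apply: measurableD; first exact: bigcupT_measurable.
    by apply: bigcup_measurable.
  - move=> m n mn; apply/subsetPset => x [Ux Cx]; split => // -[k /= km Ck].
    by apply: Cx; exists k => //=; exact: leq_trans km mn.
  - apply: (@le_lt_trans _ _ (e / 2)%:E); last by rewrite lte_fin; lra.
    apply: le_trans (epsilon_trick0 xpredT _); last lra.
    apply: (@le_trans _ _ (\sum_(n <oo) nu (U n `\` C n))%E).
      apply: measure_sigma_subadditive => //.
      + by move=> n; exact: measurableD.
      + apply: bigcapT_measurable => n; apply: measurableD.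
          exact: bigcupT_measurable.
        by apply: bigcup_measurable.
      + move=> x Fx; have [[k _ Ux] _] := Fx 0%N I.
        exists k => //; split => // Cx.
        by have [_] := Fx k.+1 I; apply; exists k => /=.
    by apply: lee_nneseries => // n _; have [_ _ _ _ /ltW] := CU n.
  exists (\bigcup_(k in `I_n) C k), (\bigcup_k U k); split => //.
  + by apply: closed_bigcup => // k _; have [] := CU k.
  + by apply: bigcup_open => k _; have [] := CU k.
  + by move=> x [k _ Cx]; exists k => //; have [_ _ + _ _] := CU k; exact.
  + by move=> x [k _ Ax]; exists k => //; have [_ _ _ + _] := CU k; exact.
Qed.

(** Vitali covering: a compact subset of the union is covered by the triples of finitely many
    disjoint balls of the family. A tripled ball has length [6 * r x] while the ball itself has
    [nu]-mass at least [e * r x], whence the factor [e / 6]. Inner regularity passes from compact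
    subsets to the union. *)
Lemma ball_bigcup_lebesgue_le (R : realType)
    (nu : {measure set (measurableTypeR R) -> \bar R}) (E U : set R)
    (r : R -> R) (e : R) :
  open U -> 0 < e -> (forall x, 0 < r x) ->
  (forall x, E x -> ball x (r x) `<=` U) ->
  (forall x, E x -> (e * r x)%:E <= nu (ball x (r x)))%E ->
  ((e / 6)%:E * @lebesgue_measure R (\bigcup_(x in E) ball x (r x)) <= nu U)%E.
Proof.
move=> oU e0 r0 rU rnu.
have oB : open (\bigcup_(x in E) ball x (r x)).
  by apply: bigcup_open => x _; exact: ball_open.
rewrite -lee_pdivlMl ?divr_gt0//.
rewrite lebesgue_regularity_inner_sup; last exact: open_measurable.
apply: ge_ereal_sup => _ [K [cK KO] <-].
move: cK; rewrite compact_cover => /(_ _ E (fun x => ball x (r x))).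
case=> [x _|//|s sE Ks]; first exact: ball_open.
have [D [uD Ds tD sD]] := vitali_lemma_finite_cover
  (fun x => is_ball_ball x (r x)) (fun x => ex_intro _ x (ballxx x (r0 x)))
  (finmap.enum_fset s).
have DE x : x \in D -> E x by move=> /Ds/sE; rewrite inE.
apply: (@le_trans _ _ (\sum_(x <- D) (6 * r x)%:E)%E).
  apply: (@le_trans _ _ (lebesgue_measure
      (cover [set` D] (scale_ball 3 \o fun x => ball x (r x))))).
    apply: le_outer_measure; exact: subset_trans Ks sD.
  rewrite /cover bigcup_seq.
  elim: (D) => [|x t IH]; first by rewrite !big_nil measure0.
  rewrite !big_cons (le_trans (outer_measureU2 _ _ _))// leeD//.
  have -> : (scale_ball 3 \o fun x => ball x (r x)) x = ball x (3 * r x).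
    by rewrite /= scale_ballE.
  apply: (@le_trans _ _ (lebesgue_measure (ball x (3 * r x)))) => //.
  rewrite lebesgue_measure_ball; last by rewrite mulr_ge0// ltW.
  by rewrite lee_fin -mulr_natl; lra.
rewrite lee_pdivlMl ?divr_gt0//.
apply: (@le_trans _ _ (nu (\bigcup_(x in [set` D]) ball x (r x)))); last first.
  apply: le_measure; rewrite ?inE.
  - apply: open_measurable; apply: bigcup_open => x _; exact: ball_open.
  - exact: open_measurable.
  - by move=> y [x /DE Ex]; apply: rU.
rewrite measure_fin_bigcup//=; [|exact: finite_seq|by move=> x _; exact: measurable_ball].
rewrite -fsbig_seq//= ge0_sume_distrr; last first.
  by move=> x _; rewrite lee_fin mulr_ge0// ltW.
rewrite big_seq [leRHS]big_seq; apply: lee_sum => x /DE/rnu; apply: le_trans.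
by rewrite -EFinM lee_fin mulrA divfK.
Qed.

(** A point off [A] where the derivative fails to be zero lies in some [E e]. The complement of [A]
    is [nu]-null, so regularity encloses it in an open set of small [nu]-mass, and the covering
    estimate then makes [E e] Lebesgue-null. *)
Lemma singular_measure_derivative (R : realType)
    (nu : {measure set (measurableTypeR R) -> \bar R}) (A : set (measurableTypeR R)) :
  (nu setT < +oo)%E -> measurable A -> @lebesgue_measure R A = 0%E ->
  nu (~` A) = 0%E ->
  {ae @lebesgue_measure R, forall x : R, forall e : R, 0 < e ->
    exists2 d, 0 < d &
      forall r, 0 < r -> r < d -> (nu (ball x r) <= (e * r)%:E)%E}.
Proof.
move=> nufin mA A0 nuA.
pose E e := [set x : R | ~ A x /\ forall d, 0 < d ->
  exists r, [/\ 0 < r, r < d & ((e * r)%:E < nu (ball x r))%E]].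
have Esmall e (h : R) : 0 < e -> 0 < h ->
    exists O : set R, [/\ open O, E e `<=` O & (@lebesgue_measure R O <= h%:E)%E].
  move=> e0 h0.
  (* With this bound on the mass of [U], the factor [e / 6] of the covering estimate cancels and [h]
     remains. *)
  have eh0 : 0 < e / 6 * h by rewrite !mulr_gt0// invr_gt0.
  have [C [U [cC oU CA AU nuU]]] :=
    finite_measure_regular nufin (measurableC mA) eh0.
  have {}nuU : (nu U <= (e / 6 * h)%:E)%E.
    rewrite -(setDKU (subset_trans CA AU)).
    have mC : measurable (C : set (measurableTypeR R)) by exact: closed_measurable.
    have mU : measurable (U : set (measurableTypeR R)) by exact: open_measurable.
    apply: le_trans (measureU2 _ (measurableD mU mC) mC) _.
    rewrite -[leRHS]adde0; apply: leeD; first exact: ltW.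
    rewrite le_eqVlt; apply/orP; left; apply/eqP.
    exact: (subset_measure0 mC (measurableC mA) CA nuA).
  (* Outside [E e] the radius [1] is a dummy value that makes [r] a total positive function. *)
  have /choice[r rP] : forall x, exists r, 0 < r /\
      (E e x -> ball x r `<=` U /\ (e * r)%:E <= nu (ball x r))%E.
    move=> x; have [[Ax Ex]|?] := pselect (E e x); last by exists 1.
    have /nbhs_ballP[d /= d0 dU] := open_nbhs_nbhs (conj oU (AU _ Ax)).
    have [r [r0 rd nur]] := Ex d d0.
    exists r; split => // _; split; last exact: ltW.
    exact: subset_trans (le_ball (ltW rd)) dU.
  exists (\bigcup_(x in E e) ball x (r x)); split.
  - by apply: bigcup_open => x _; exact: ball_open.
  - by move=> x Ex; exists x => //; apply: ballxx; have [] := rP x.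
  - have := @ball_bigcup_lebesgue_le R nu (E e) U r e oU e0.
    move=> /(_ (fun x => (rP x).1)) /(_ (fun x Ex => ((rP x).2 Ex).1)).
    move=> /(_ (fun x Ex => ((rP x).2 Ex).2)) /le_trans /(_ nuU).
    by rewrite [(e / 6 * h)%:E]EFinM lee_pmul2l// lte_fin divr_gt0.
have E0 e : 0 < e -> (@lebesgue_measure R).-negligible (E e).
  move=> e0.
  have hn (n : nat) : 0 < n.+1%:R^-1 :> R by rewrite invr_gt0.
  have /choice[V VP] := fun n => Esmall e _ e0 (hn n).
  have mO n : measurable (V n : set (measurableTypeR R)).
    by apply: open_measurable; have [] := VP n.
  exists (\bigcap_n V n); split.
  - exact: bigcapT_measurable.
  - apply/eqP; rewrite eq_le measure_ge0 andbT; apply/lee_addgt0Pr => h h0.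
    rewrite add0e.
    have [n nh] := @ltr_add_invr R 0 h h0.
    rewrite add0r in nh.
    apply: (@le_trans _ _ n.+1%:R^-1%:E); last by rewrite lee_fin ltW.
    have [_ _] := VP n; apply: le_trans; apply: le_outer_measure.
    exact: bigcap_inf.
  - by move=> x Ex n _; have [_ EV _] := VP n; exact: EV.
(* The exceptional set must not depend on [e]; the bound is monotone in [e], so the countably many
   values [n.+1%:R^-1] suffice. *)
have : (@lebesgue_measure R).-negligible (A `|` \bigcup_n E n.+1%:R^-1).
  apply: negligibleU; first by exists A; split.
  by apply: negligible_bigcup => n; apply: E0; rewrite invr_gt0.
apply: negligibleS => x; apply: contra_notP.
move=> /not_orP[nAx nEx] e e0.
have [n ne] := @ltr_add_invr R 0 e e0.
rewrite add0r in ne.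
apply: contrapT => H; apply: nEx; exists n => //; split => // d d0.
apply: contrapT => H2; apply: H; exists d => // r r0 rd.
rewrite leNgt; apply/negP => er; apply: H2; exists r; split => //.
by apply: le_lt_trans er; rewrite lee_fin ler_pM2r// ltW.
Qed.

(** * Approximate identities *)

Lemma ge0_le_integralM (R : realType)
    (nu : {measure set (measurableTypeR R) -> \bar R})
    (S : set (measurableTypeR R)) (k g : R -> R) (M : R) :
  measurable S -> measurable_fun S k -> measurable_fun S g -> 0 <= M ->
  (forall t, S t -> 0 <= k t <= M) -> (forall t, S t -> 0 <= g t) ->
  (\int[nu]_(t in S) (k t * g t)%:E <= M%:E * \int[nu]_(t in S) (g t)%:E)%E.
Proof.
move=> mS mk mg M0 kM g0.
rewrite -ge0_integralZl//; last by apply/measurable_EFinP.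
apply: ge0_le_integral => //.
- by move=> t St; rewrite lee_fin mulr_ge0 ?g0//; have /andP[] := kM t St.
- by apply/measurable_EFinP; exact: measurable_funM.
- by apply/measurable_EFinP; exact: measurable_funM.
- by move=> t St; rewrite lee_fin ler_wpM2r ?g0//; have /andP[] := kM t St.
Qed.

(* Stated for a measure g dnu of zero density at x, so as to apply both at the
   Lebesgue points of a function (g = |h - h x|) and to singular measures (g = 1). *)
Lemma approximate_identity_cvg0 (R : realType)
    (nu : {measure set (measurableTypeR R) -> \bar R})
    (D : set (measurableTypeR R)) (x : R) (k : nat -> R -> R) (g : R -> R) (C : R) :
  measurable D -> (forall n, measurable_fun D (k n)) -> measurable_fun D g ->
  (forall t, D t -> 0 <= g t) -> (\int[nu]_(t in D) (g t)%:E < +oo)%E ->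
  (forall e, 0 < e -> exists2 d, 0 < d & forall r, 0 < r -> r < d ->
     (\int[nu]_(t in D `&` ball x r) (g t)%:E <= (e * r)%:E)%E) ->
  (forall n t, D t -> 0 <= k n t <= C * n.+1%:R) ->
  (forall n t, D t -> k n t * n.+1%:R * (x - t) ^+ 2 <= C) ->
  forall e, 0 < e -> \forall n \near \oo,
    (\int[nu]_(t in D) (k n t * g t)%:E <= e%:E)%E.
Proof.
move=> mD mk mg g0 gfin gx kC kx e e0.
wlog C1 : C kC kx / 1 <= C.
  move=> H; apply: (H (Num.max C 1)) => //; last by rewrite le_max lexx orbT.
  - move=> n t Dt; have /andP[-> /= kn] := kC n t Dt.
    by rewrite (le_trans kn)// ler_wpM2r// le_max lexx.
  - by move=> n t Dt; rewrite (le_trans (kx n t Dt))// le_max lexx.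
have C0 : 0 < C by exact: lt_le_trans C1.
(* The dyadic sum over the balls inside radius [d] stays below [5 * C * e'], which is [e / 2]; the
   other half is left for the far part. *)
pose e' := e / (10 * C).
have e'0 : 0 < e' by rewrite divr_gt0// mulr_gt0.
have [d d0 gd] := gx _ e'0.
have mB r : measurable (D `&` ball x r : set (measurableTypeR R)).
  by apply: measurableI => //; exact: measurable_ball.
have mSub S (f : R -> R) : measurable_fun D f -> measurable_fun (D `&` S) f.
  by apply: measurable_funS => //; exact: subIsetl.
have kg0 n t : D t -> 0 <= k n t * g t.
  by move=> Dt; rewrite mulr_ge0 ?g0//; have /andP[] := kC n t Dt.
(* Growing the ball dyadically, the K-th shell contributes at most 2 C e' / 2^K. *)
have step n K : n.+1%:R^-1 * 2 ^+ K < d ->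
    (\int[nu]_(t in D `&` ball x (n.+1%:R^-1 * 2 ^+ K)) (k n t * g t)%:E
      <= (C * e' * (5 - 4 / 2 ^+ K))%:E)%E.
  elim: K => [|K IH] Kd.
    apply: le_trans (ge0_le_integralM _ (mB _) (mSub _ _ (mk n)) (mSub _ _ mg) _
      (fun t tD => kC n t tD.1) (fun t tD => g0 t tD.1)) _; first by rewrite mulr_ge0// ltW.
    apply: (@le_trans _ _ ((C * n.+1%:R)%:E * (e' * (n.+1%:R^-1 * 2 ^+ 0))%:E)%E).
      apply: lee_wpmul2l; first by rewrite lee_fin mulr_ge0// ltW.
      by apply: gd => //; rewrite mulr_gt0 ?exprn_gt0 ?invr_gt0.
    rewrite -EFinM lee_fin expr0 le_eqVlt; apply/orP; left; apply/eqP.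
    by field.
  have Kd' : n.+1%:R^-1 * 2 ^+ K < d.
    by apply: le_lt_trans Kd; rewrite ler_wpM2l// ler_weXn2l// ler1n.
  set B1 := ball x (n.+1%:R^-1 * 2 ^+ K.+1); set B0 := ball x (n.+1%:R^-1 * 2 ^+ K).
  have B01 : B0 `<=` B1.
    by apply: le_ball; rewrite ler_wpM2l// ler_weXn2l// ler1n.
  have -> : D `&` B1 = (D `&` B0) `|` (D `&` (B1 `\` B0)).
    by rewrite -setIUr setUC setDKU.
  have mD1 : measurable (D `&` (B1 `\` B0) : set (measurableTypeR R)).
    apply: measurableI => //; apply: measurableD; exact: measurable_ball.
  rewrite ge0_integral_setU//=; last 4 first.
  - exact: mB.
  - apply/measurable_EFinP; rewrite -setIUr; apply: mSub.
    exact: measurable_funM.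
  - by move=> t [|] [Dt _]; rewrite lee_fin kg0.
  - by apply/disj_setPS => t [[_ ?] [_ [_ ?]]].
  (* On the new shell the decay bound gives [k n t <= C * n.+1%:R / 4 ^+ K], and the mass of [g] is
     at most [e'] times the outer radius. *)
  have -> : C * e' * (5 - 4 / 2 ^+ K.+1) =
      C * e' * (5 - 4 / 2 ^+ K) + C * n.+1%:R / 4 ^+ K * (e' * (n.+1%:R^-1 * 2 ^+ K.+1)).
    rewrite (_ : 4 = 2 * 2 :> R) ?exprMn; last lra.
    by rewrite exprS; field; rewrite nat1r pnatr_eq0 expf_neq0.
  rewrite EFinD; apply: leeD; first exact: IH.
  have M0 : 0 <= C * n.+1%:R / 4 ^+ K.
    by rewrite divr_ge0 ?exprn_ge0// mulr_ge0// ltW.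
  apply: le_trans (ge0_le_integralM _ mD1 (mSub _ _ (mk n)) (mSub _ _ mg) M0
      _ (fun t tD => g0 t tD.1)) _.
    move=> t [Dt [_ B0t]]; have /andP[-> _ /=] := kC n t Dt.
    have {B0t} : n.+1%:R^-1 * 2 ^+ K <= `|x - t| by rewrite leNgt; apply/negP.
    rewrite -(@ler_pXn2r _ 2)// ?nnegrE ?mulr_ge0 ?exprn_ge0//.
    rewrite real_normK ?num_real// => xt.
    have k0 : 0 <= k n t * n.+1%:R.
      by rewrite mulr_ge0//; have /andP[] := kC n t Dt.
    have := le_trans (ler_wpM2l k0 xt) (kx n t Dt).
    rewrite exprMn -exprM mulnC exprM (_ : 2 ^+ 2 = 4 :> R); last lra.
    rewrite ler_pdivlMr ?exprn_gt0//.
    rewrite -(@ler_pM2r _ n.+1%:R) ?ltr0n//.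
    apply: le_trans; rewrite le_eqVlt; apply/orP; left; apply/eqP.
    by field.
  rewrite [leRHS]EFinM; apply: lee_wpmul2l; first by rewrite lee_fin.
  apply: le_trans (gd _ _ Kd); last by rewrite mulr_gt0 ?exprn_gt0 ?invr_gt0.
  apply: ge0_subset_integral => //.
  - by apply/measurable_EFinP; exact: mSub.
  - by move=> t [Dt _]; rewrite lee_fin g0.
  - by apply: setIS => t [].
have [G G0 Gfin] : exists2 G : R, 0 <= G &
    (\int[nu]_(t in D) (g t)%:E)%E = G%:E.
  have Gge0 : (0 <= \int[nu]_(t in D) (g t)%:E)%E.
    by apply: integral_ge0 => t Dt; rewrite lee_fin g0.
  exists (fine (\int[nu]_(t in D) (g t)%:E)%E); first exact: fine_ge0.
  by rewrite fineK// ge0_fin_numE.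
near=> n.
have nd : n.+1%:R^-1 < d.
  by near: n; exact: near_infty_natSinv_lt (PosNum d0).
(* Makes the far part at most [e / 2]; [G + 1] instead of [G] keeps the divisor positive. *)
have nG : n.+1%:R^-1 < e / (8 * C / d ^+ 2 * (G + 1)).
  near: n; apply: (near_infty_natSinv_lt (PosNum _)).
  by rewrite !divr_gt0// ?mulr_gt0 ?invr_gt0 ?exprn_gt0//; lra.
(* The largest dyadic radius below [d]. It is at least [d / 2], so that off this ball [k n] is at
   most [4 * C / d ^+ 2 / n.+1%:R]. *)
have [K [Kd Kd2]] : exists K, n.+1%:R^-1 * 2 ^+ K < d /\ d <= n.+1%:R^-1 * 2 ^+ K.+1.
  have ex : exists K, d <= n.+1%:R^-1 * 2 ^+ K.+1 :> R.
    exists (Num.trunc (d * n.+1%:R)).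
    rewrite ler_pdivlMl ?ltr0n// mulrC.
    have := truncnS_gt (d * n.+1%:R).
    move=> /ltW/le_trans; apply.
    by rewrite -natrX ler_nat ltnW// ltn_expl.
  exists (ex_minn ex); case: ex_minnP => K dK minK; split => //.
  case: K dK minK => [|K] dK minK; first by rewrite expr0 mulr1.
  by rewrite ltNge; apply/negP => /minK; rewrite ltnn.
have mD1 : measurable (D `&` ~` ball x (n.+1%:R^-1 * 2 ^+ K) : set (measurableTypeR R)).
  by apply: measurableI => //; apply: measurableC; exact: measurable_ball.
have -> : D = (D `&` ball x (n.+1%:R^-1 * 2 ^+ K)) `|`
    (D `&` ~` ball x (n.+1%:R^-1 * 2 ^+ K)).
  by rewrite -setIUr setUCr setIT.
rewrite ge0_integral_setU//=; last 3 first.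
- apply/measurable_EFinP; rewrite -setIUr; apply: mSub.
  exact: measurable_funM.
- by move=> t [|] [Dt _]; rewrite lee_fin kg0.
- by apply/disj_setPS => t [[_ ?] [_ ?]].
have -> : e = e / 2 + e / 2 by lra.
rewrite EFinD; apply: leeD.
  apply: le_trans (step n K Kd) _; rewrite lee_fin.
  rewrite (_ : e / 2 = C * e' * 5); last by rewrite /e'; field; rewrite gt_eqF.
  rewrite ler_wpM2l//; first by rewrite mulr_ge0// ltW.
  rewrite gerDl oppr_le0.
  by rewrite divr_ge0// exprn_ge0.
have M0 : 0 <= 4 * C / d ^+ 2 / n.+1%:R.
  by rewrite !divr_ge0 ?exprn_ge0// ?mulr_ge0// ltW.
apply: le_trans (ge0_le_integralM _ mD1 (mSub _ _ (mk n)) (mSub _ _ mg) M0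
      _ (fun t tD => g0 t tD.1)) _.
  move=> t [Dt B0t]; have /andP[k0 _ /=] := kC n t Dt; rewrite k0/=.
  have {B0t} xt : n.+1%:R^-1 * 2 ^+ K <= `|x - t| by rewrite leNgt; apply/negP.
  have {xt} : d / 2 <= `|x - t|.
    apply: le_trans xt; rewrite ler_pdivrMr//.
    by rewrite -mulrA -exprSr.
  rewrite -(@ler_pXn2r _ 2)// ?nnegrE ?divr_ge0 ?(ltW d0)//.
  rewrite real_normK ?num_real// => xt.
  have kn0 : 0 <= k n t * n.+1%:R by rewrite mulr_ge0.
  have := le_trans (ler_wpM2l kn0 xt) (kx n t Dt).
  rewrite ler_pdivlMr ?ltr0n// ler_pdivlMr ?exprn_gt0//.
  move: (k n t) (n.+1%:R) => u v; rewrite expr_div_n -mulrA => h.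
  rewrite mulrC; lra.
apply: (@le_trans _ _ ((4 * C / d ^+ 2 / n.+1%:R)%:E * G%:E)%E).
  apply: lee_wpmul2l; first by rewrite lee_fin.
  rewrite -Gfin; apply: ge0_subset_integral => //.
  by apply/measurable_EFinP.
rewrite -EFinM lee_fin.
have G1 : 0 < 8 * C / d ^+ 2 * (G + 1).
  by rewrite mulr_gt0 ?divr_gt0 ?exprn_gt0 ?mulr_gt0//; lra.
move: nG; rewrite ltr_pdivlMr// => nG.
have P0 : 0 <= 4 * C / d ^+ 2 / n.+1%:R by [].
apply: (@le_trans _ _ (4 * C / d ^+ 2 / n.+1%:R * (G + 1))).
  by rewrite ler_wpM2l//; lra.
apply: ltW; rewrite ltr_pdivlMr//; apply: le_lt_trans nG.
by rewrite le_eqVlt; apply/orP; left; apply/eqP; ring.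
Unshelve. all: by end_near. Qed.

(** * The Fejer kernel *)

Section unit_circle.
Variable R : realType.
Implicit Types (x y : R) (z w : R[i]).

Lemma ReD z w : complex.Re (z + w) = complex.Re z + complex.Re w.
Proof. by case: z w => ? ? []. Qed.

Lemma ImD z w : complex.Im (z + w) = complex.Im z + complex.Im w.
Proof. by case: z w => ? ? []. Qed.

Lemma expiD x y : expi (x + y) = expi x * expi y.
Proof. by rewrite /expi cosD sinD; simpc; rewrite [sin x * _ + _]addrC. Qed.

Lemma expi0 : expi (0 : R) = 1.
Proof. by rewrite /expi cos0 sin0. Qed.

Lemma expiX x k : expi x ^+ k = expi (x * k%:R).
Proof.
elim: k => [|k IH]; first by rewrite mulr0 expi0.
by rewrite exprS IH -expiD -natr1 mulrDr mulr1 addrC.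
Qed.

Lemma conj_expi x : conjc (expi x) = expi (- x).
Proof. by rewrite /expi cosN sinN. Qed.

(** Valued in [R], hence integrable as it stands, whereas the norm of [R[i]] takes its values in
    [R[i]]. *)
Definition sqnormc z : R := complex.Re z ^+ 2 + complex.Im z ^+ 2.

Lemma sqnormc_ge0 z : 0 <= sqnormc z.
Proof. by rewrite addr_ge0// sqr_ge0. Qed.

Lemma sqnormc_eq0 z : (sqnormc z == 0) = (z == 0).
Proof. by case: z => a b; rewrite /sqnormc paddr_eq0 ?sqr_ge0// !sqrf_eq0 eq_complex. Qed.

Lemma mulc_conjc z : z * conjc z = (sqnormc z)%:C.
Proof. by case: z => a b; rewrite /sqnormc /=; simpc; congr (_ +i* _); ring. Qed.

Lemma sqnormcM z w : sqnormc (z * w) = sqnormc z * sqnormc w.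
Proof. by case: z => a b; case: w => c d; rewrite /sqnormc; simpc => /=; ring. Qed.

Lemma sqnormc_expi x : sqnormc (expi x) = 1.
Proof. by rewrite /sqnormc /expi /= cos2Dsin2. Qed.

Lemma sqnormc_expiB1 x : sqnormc (expi (x *+ 2) - 1) = 4 * sin x ^+ 2.
Proof.
rewrite /sqnormc /expi /= oppr0 addr0 cos_mulr2n sin_mulr2n.
rewrite -(cos2Dsin2 x); ring.
Qed.

(** With y = pi x / 2, sin(2 y) = 2 cos(y) sin(y). On [0, pi M / 2] the cosine is at least [k],
    hence sin(y) >= k y by the mean value theorem, which gives the constant [pi * k ^+ 2]. It
    degenerates as M tends to 1, where sin(pi x) vanishes again. *)
Lemma sin_ge_linear (M : R) : 0 < M < 1 ->
  exists2 c, 0 < c & forall x, `|x| <= M -> c * `|x| <= `|sin (pi * x)|.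
Proof.
move=> /andP[M0 M1].
have pi0 : 0 < pi :> R := pi_gt0 R.
set k := cos (pi * M / 2).
have k0 : 0 < k.
  apply: cos_gt0_pihalf; apply/andP; split.
    by apply: (@lt_trans _ _ 0); [rewrite oppr_lt0 divr_gt0|rewrite divr_gt0 ?mulr_gt0].
  by rewrite ltr_pM2r ?invr_gt0// gtr_pMr.
have cosk y : 0 <= y <= pi * M / 2 -> k <= cos y.
  move=> /andP[y0 yM]; rewrite /k leNgt ltr_cos -?leNgt // in_itv/=; last first.
    rewrite y0/=; apply: (le_trans yM); rewrite ler_pdivrMr// ler_pM2l//; lra.
  apply/andP; split; first by rewrite divr_ge0// mulr_ge0// ltW.
  rewrite ler_pdivrMr// ler_pM2l//; lra.
exists (pi * k ^+ 2); first by rewrite mulr_gt0// exprn_gt0.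
move=> x xM.
have -> : `|sin (pi * x)| = `|sin (pi * `|x|)|.
  by case: (ger0P x) => // _; rewrite mulrN sinN normrN.
have := normr_ge0 x; move: `|x| xM => {}x xM x0.
have y0 : 0 <= pi * x / 2 by rewrite divr_ge0// mulr_ge0// ltW.
have yM : pi * x / 2 <= pi * M / 2 by rewrite ler_pM2r ?invr_gt0// ler_pM2l.
have sy : k * (pi * x / 2) <= sin (pi * x / 2).
  have [v /[!in_itv]/= /andP[v0 vy]] := @MVT_segment R sin cos _ _ y0
    (fun v _ => is_derive_sin v) (continuous_subspaceT (@continuous_sin R)).
  rewrite sin0 !subr0 => ->; rewrite ler_wpM2r//; apply: cosk.
  by rewrite v0 (le_trans vy).
apply: le_trans (ler_norm _).
rewrite (_ : sin (pi * x) = 2 * cos (pi * x / 2) * sin (pi * x / 2)); last first.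
  by rewrite -mulrA mulr_natl -sin_mulr2n -[_ *+ 2]mulr_natr divfK.
have cy : k <= cos (pi * x / 2) by apply: cosk; rewrite y0.
apply: (@le_trans _ _ (2 * k * (k * (pi * x / 2)))).
  by rewrite le_eqVlt; apply/orP; left; apply/eqP; field.
apply: ler_pM => //.
- by rewrite mulr_ge0// ltW.
- by rewrite mulr_ge0// ltW.
- by rewrite ler_pM2l.
Qed.

(** The factor 2 comes from bounding the real and the imaginary part separately by [n]. *)
Lemma sqnormc_sum_expi x n : sqnormc (\sum_(l < n) expi x ^+ l) <= 2 * n%:R ^+ 2.
Proof.
have sq_le (f : 'I_n -> R) : (forall i, `|f i| <= 1) -> (\sum_i f i) ^+ 2 <= n%:R ^+ 2.
  move=> f1; rewrite -(@real_normK _ (\sum_i f i)) ?num_real//.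
  rewrite ler_pXn2r ?nnegrE//; apply: le_trans (ler_norm_sum _ _ _) _.
  apply: le_trans (ler_sum _ (fun i _ => f1 i)) _.
  by rewrite sumr_const card_ord.
have ReS (I : Type) (s : seq I) (f : I -> R[i]) :
    complex.Re (\sum_(i <- s) f i) = \sum_(i <- s) complex.Re (f i).
  by apply: (big_morph _ ReD).
have ImS (I : Type) (s : seq I) (f : I -> R[i]) :
    complex.Im (\sum_(i <- s) f i) = \sum_(i <- s) complex.Im (f i).
  by apply: (big_morph _ ImD).
rewrite /sqnormc mulr_natl mulr2n ReS ImS lerD// sq_le// => i; rewrite expiX/=.
  by rewrite ler_norml cos_geN1 cos_le1.
by rewrite ler_norml sin_geN1 sin_le1.
Qed.

(** Kept as a squared Dirichlet sum: the quotient of sines would be undefined at [t = x]. *)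
Definition fejer (x : R) (N : nat) (t : R) : R :=
  sqnormc (\sum_(l < N.+1) expi (2 * pi * (t - x)) ^+ l) / N.+1%:R.

Lemma fejer_ge0 x N t : 0 <= fejer x N t.
Proof. by rewrite divr_ge0 ?sqnormc_ge0. Qed.

Lemma fejer_le x N t : fejer x N t <= 2 * N.+1%:R.
Proof.
rewrite ler_pdivrMr ?ltr0n// -[leRHS]mulrA -expr2; exact: sqnormc_sum_expi.
Qed.

(** The geometric sum times [expi (2 * pi * (t - x)) - 1] has squared modulus at most 4, and that
    factor has squared modulus 4 sin(pi (t - x))^2. For t in [0, 1] the distance |t - x| is at most
    max(x, 1 - x) < 1, so the sine is bounded below linearly. *)
Lemma fejer_decay x : 0 < x < 1 -> exists C, forall N t, 0 <= t <= 1 ->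
  fejer x N t * N.+1%:R * (x - t) ^+ 2 <= C.
Proof.
move=> /andP[x0 x1].
have [|c c0 cs] := @sin_ge_linear (Num.max x (1 - x)).
  by rewrite lt_max x0/= gt_max x1/=; lra.
exists (c ^- 2) => N t /andP[t0 t1].
rewrite divfK ?pnatr_eq0// -div1r ler_pdivlMr ?exprn_gt0//.
have tx : c * `|t - x| <= `|sin (pi * (t - x))|; first apply: cs.
  by rewrite le_max !ler_norml; apply/orP; case: (leP x t) => xt;
    [right|left]; apply/andP; split; lra.
have w1 : sqnormc (expi (2 * pi * (t - x)) - 1) = 4 * sin (pi * (t - x)) ^+ 2.
  by rewrite -sqnormc_expiB1 -mulrA mulr_natl.
have wn : sqnormc (expi (2 * pi * (t - x)) ^+ N.+1 - 1) <= 4.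
  rewrite expiX (_ : _ * _ * _ * _ = (pi * (t - x) * N.+1%:R) *+ 2); last first.
    by rewrite -mulr_natl; ring.
  rewrite sqnormc_expiB1 sin2cos2.
  have := sqr_ge0 (cos (pi * (t - x) * N.+1%:R)); lra.
move: wn; rewrite subrX1 sqnormcM w1.
set S := sqnormc _ => h.
have S0 : 0 <= S by exact: sqnormc_ge0.
have : c ^+ 2 * (x - t) ^+ 2 <= sin (pi * (t - x)) ^+ 2.
  rewrite -(sqrrN (x - t)) opprB -(@real_normK _ (sin _)) ?num_real//.
  rewrite -(@real_normK _ (t - x)) ?num_real// -exprMn ler_pXn2r ?nnegrE//.
  by rewrite mulr_ge0// ltW.
move=> /(ler_wpM2l S0) h2; nra.
Qed.

End unit_circle.

(** * Integrals of complex-valued functions *)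

Section complex_integral.
Variable R : realType.
Implicit Types (f g : R -> R[i]).

(** Componentwise, to match [Cintegral]: both parts are then integrable on [0, 1] for any measure
    finite there. *)
Definition ccontinuous f :=
  continuous (fun t => complex.Re (f t) : R) /\ continuous (fun t => complex.Im (f t) : R).

Lemma ccontinuous_cst c : ccontinuous (fun=> c).
Proof. by split=> t; exact: cvg_cst. Qed.

Lemma ccontinuousD f g : ccontinuous f -> ccontinuous g ->
  ccontinuous (fun t => f t + g t).
Proof.
move=> [rf mf] [rg mg]; split=> t.
  by under eq_fun do rewrite ReD; apply: cvgD; [exact: rf|exact: rg].
by under eq_fun do rewrite ImD; apply: cvgD; [exact: mf|exact: mg].
Qed.

Lemma ccontinuousM f g : ccontinuous f -> ccontinuous g ->
  ccontinuous (fun t => f t * g t).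
Proof.
have ReM (z w : R[i]) : complex.Re (z * w) =
  complex.Re z * complex.Re w - complex.Im z * complex.Im w by case: z w => ? ? [].
have ImM (z w : R[i]) : complex.Im (z * w) =
  complex.Re z * complex.Im w + complex.Im z * complex.Re w by case: z w => ? ? [].
move=> [rf mf] [rg mg]; split=> t.
  under eq_fun do rewrite ReM; apply: cvgB; apply: cvgM;
    by [exact: rf|exact: rg|exact: mf|exact: mg].
under eq_fun do rewrite ImM; apply: cvgD; apply: cvgM;
  by [exact: rf|exact: rg|exact: mf|exact: mg].
Qed.

Lemma ccontinuous_conjc f : ccontinuous f -> ccontinuous (fun t => conjc (f t)).
Proof.
have ReC (z : R[i]) : complex.Re (conjc z) = complex.Re z by case: z.
have ImC (z : R[i]) : complex.Im (conjc z) = - complex.Im z by case: z.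
move=> [rf mf]; split=> t.
  by under eq_fun do rewrite ReC; exact: rf.
by under eq_fun do rewrite ImC; apply: cvgN; exact: mf.
Qed.

Lemma ccontinuous_sum (I : Type) (s : seq I) (F : I -> R -> R[i]) :
  (forall i, ccontinuous (F i)) -> ccontinuous (fun t => \sum_(i <- s) F i t).
Proof.
move=> cF; elim: s => [|i s IH].
  by under [X in ccontinuous X]eq_fun do rewrite big_nil; exact: ccontinuous_cst.
under [X in ccontinuous X]eq_fun do rewrite big_cons.
exact: ccontinuousD.
Qed.

Lemma ccontinuous_expi (a : R) : ccontinuous (fun t => expi (a * t)).
Proof.
split=> t /=; apply: continuous_comp; try exact: mulrl_continuous.
  exact: continuous_cos.
exact: continuous_sin.
Qed.

Lemma ccontinuousX f k : ccontinuous f -> ccontinuous (fun t => f t ^+ k).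
Proof.
move=> cf; elim: k => [|k IH].
  by under [X in ccontinuous X]eq_fun do rewrite expr0; exact: ccontinuous_cst.
by under [X in ccontinuous X]eq_fun do rewrite exprS; exact: ccontinuousM.
Qed.

Lemma continuous_sqnormc f : ccontinuous f -> continuous (fun t => sqnormc (f t) : R).
Proof.
move=> [rf mf] t; rewrite /sqnormc.
by apply: cvgD; apply: cvgM; by [exact: rf|exact: mf].
Qed.

Variable nu : {measure set (measurableTypeR R) -> \bar R}.
Hypothesis nufin : (nu `[0%R, 1%R]%classic < +oo)%E.

Lemma continuous_integrable01 (f : R -> R) : continuous f ->
  nu.-integrable `[0, 1] (EFin \o f).
Proof.
move=> cf; apply: measurable_bounded_integrable => //.
  by apply: measurable_funTS; exact: continuous_measurable_fun.
have cfs : {within `[(0 : R), 1], continuous f} by exact: continuous_subspaceT.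
have := continuous_compact cfs (@segment_compact R 0 1).
move=> /compact_bounded [M [Mreal Mb]]; exists M; split => // x Mx t t01.
by apply: Mb => //; exists t.
Qed.

Lemma Rintegral01_0 : \int[nu]_(t in `[0, 1]) 0 = 0 :> R.
Proof. by rewrite /Rintegral integral0_eq. Qed.

Local Notation Cint := (Cintegral nu `[0, 1]%classic).

Lemma CintegralD f g : ccontinuous f -> ccontinuous g ->
  Cint (fun t => f t + g t) = Cint f + Cint g.
Proof.
move=> [rf mf] [rg mg]; rewrite /Cintegral.
under eq_Rintegral do rewrite ReD.
under [X in _ +i* X]eq_Rintegral do rewrite ImD.
by rewrite !RintegralD//; exact: continuous_integrable01.
Qed.

Lemma CintegralZl c f : ccontinuous f -> Cint (fun t => c * f t) = c * Cint f.
Proof.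
case: c => a b.
have ReM (w : R[i]) :
  complex.Re ((a +i* b) * w) = a * complex.Re w - b * complex.Im w by case: w.
have ImM (w : R[i]) :
  complex.Im ((a +i* b) * w) = a * complex.Im w + b * complex.Re w by case: w.
move=> [rf mf]; rewrite /Cintegral.
under eq_Rintegral do rewrite ReM.
under [X in _ +i* X]eq_Rintegral do rewrite ImM.
have iZ (d : R) (h : R -> R) : continuous h -> nu.-integrable `[0, 1] (EFin \o (fun t => d * h t)).
  move=> ch; apply: continuous_integrable01 => t; apply: cvgM; [exact: cvg_cst|exact: ch].
rewrite RintegralB// ?RintegralD//; try exact: iZ.
by rewrite !RintegralZl//; try exact: continuous_integrable01.
Qed.

Lemma Cintegral_sum (I : Type) (s : seq I) (F : I -> R -> R[i]) :
  (forall i, ccontinuous (F i)) ->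
  Cint (fun t => \sum_(i <- s) F i t) = \sum_(i <- s) Cint (F i).
Proof.
move=> cF; elim: s => [|i s IH].
  rewrite big_nil /Cintegral.
  under eq_Rintegral do rewrite big_nil/=.
  under [X in _ +i* X]eq_Rintegral do rewrite big_nil/=.
  by rewrite Rintegral01_0.
rewrite big_cons -IH -CintegralD//; last exact: ccontinuous_sum.
by congr Cintegral; apply/funext => t; rewrite big_cons.
Qed.

Lemma Cintegral_conjc f : ccontinuous f ->
  Cint (fun t => conjc (f t)) = conjc (Cint f).
Proof.
have ReC (z : R[i]) : complex.Re (conjc z) = complex.Re z by case: z.
have ImC (z : R[i]) : complex.Im (conjc z) = -1 * complex.Im z.
  by case: z => ? ? /=; rewrite mulN1r.
move=> [rf mf]; rewrite /Cintegral.
under eq_Rintegral do rewrite ReC.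
under [X in _ +i* X]eq_Rintegral do rewrite ImC.
by rewrite RintegralZl ?mulN1r//; exact: continuous_integrable01.
Qed.

Lemma Cintegral_real (f : R -> R) : Cint (fun t => (f t)%:C) = (\int[nu]_(t in `[0, 1]) f t)%:C.
Proof. by rewrite /Cintegral /= Rintegral01_0. Qed.

End complex_integral.

(** * Orthogonality of exponentials and trigonometric polynomials *)

Section trigonometric_polynomials.
Variable R : realType.

Lemma Rintegral01_derive (f F : R -> R) : continuous f ->
  (forall t : R, is_derive t 1 F (f t)) ->
  \int[lebesgue_measure]_(t in `[0, 1]) f t = F 1 - F 0.
Proof.
move=> cf dF.
have cF (t : R) : {for t, continuous F}.
  by apply: differentiable_continuous; apply/derivable1_diffP; exact: ex_derive.
rewrite /Rintegral (@continuous_FTC2 _ f F 0 1)//.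
- exact: continuous_subspaceT.
- split.
  + by move=> t _; exact: ex_derive.
  + exact: cvg_at_right_filter (cF 0).
  + exact: cvg_at_left_filter (cF 1).
- by move=> t _; rewrite derive1E; exact: derive_val.
Qed.

Lemma is_derive_scale_comp (g dg : R -> R) (a b t : R) :
  (forall x : R, is_derive x 1 g (dg x)) ->
  is_derive t 1 (fun t => b * g (a * t)) (b * (dg (a * t) * a)).
Proof.
move=> gd.
have da : is_derive t 1 (fun t => a * t) a.
  by apply: is_derive_eq; rewrite /GRing.scale/= mulr1.
have dga := is_derive1_comp (gd (a * t)) da.
exact: (@is_deriveZ _ _ _ (g \o (fun t => a * t)) b t 1 _ dga).
Qed.

Lemma expi_2pi k : expi (2 * pi * k%:R : R) = 1.
Proof.
rewrite -expiX (_ : expi (2 * pi) = 1) ?expr1n//.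
by rewrite mulr_natl /expi cos2pi sin2pi.
Qed.

(** Off the diagonal the integrand is [expi (a * t)] with [a] a nonzero multiple of 2 pi, so its
    primitive takes the same value at 0 and 1. *)
Lemma Cintegral_expi (j l : nat) :
  Cintegral (@lebesgue_measure R) `[0, 1]
    (fun t => expi (2 * pi * t) ^+ j * conjc (expi (2 * pi * t) ^+ l)) = (j == l)%:R.
Proof.
pose a : R := 2 * pi * (j%:R - l%:R).
have fE : (fun t : R => expi (2 * pi * t) ^+ j * conjc (expi (2 * pi * t) ^+ l)) =
    (fun t => expi (a * t)).
  apply/funext => t; rewrite !expiX conj_expi -expiD /a.
  by congr expi; ring.
rewrite fE /Cintegral /=.
have [jl|jl] := eqVneq j l.
  rewrite /a jl subrr mulr0.
  under eq_Rintegral do rewrite mul0r cos0.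
  under [X in _ +i* X]eq_Rintegral do rewrite mul0r sin0.
  rewrite Rintegral01_0 Rintegral_cst//= lebesgue_measure_itv/= lte_fin ltr01.
  by rewrite -EFinD /= subr0 mul1r.
have a0 : a != 0.
  by rewrite mulf_neq0 ?subr_eq0 ?eqr_nat// mulf_neq0// gt_eqF// pi_gt0.
have [ca sa] : cos a = 1 /\ sin a = 0.
  have : expi a = 1.
    rewrite /a mulrBr expiD expi_2pi mul1r -[expi _]conjcK conj_expi opprK expi_2pi.
    by rewrite rmorph1.
  by rewrite /expi; case.
have Icos : \int[lebesgue_measure]_(t in `[0, 1]) cos (a * t) =
    a^-1 * sin (a * 1) - a^-1 * sin (a * 0).
  apply: (@Rintegral01_derive (fun t => cos (a * t)) (fun t => a^-1 * sin (a * t))).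
    exact: (ccontinuous_expi a).1.
  move=> t; have -> : cos (a * t) = a^-1 * (cos (a * t) * a) by field.
  exact: is_derive_scale_comp.
have Isin : \int[lebesgue_measure]_(t in `[0, 1]) sin (a * t) =
    - (a^-1 * cos (a * 1)) + a^-1 * cos (a * 0).
  rewrite -[X in _ + X]opprK.
  apply: (@Rintegral01_derive (fun t => sin (a * t)) (fun t => - (a^-1 * cos (a * t)))).
    exact: (ccontinuous_expi a).2.
  move=> t; have -> : sin (a * t) = - (a^-1 * (- sin (a * t) * a)) by field.
  by apply: is_deriveN; exact: is_derive_scale_comp.
rewrite Icos Isin.
by rewrite !mulr1 !mulr0 sin0 sa cos0 ca mulr0 addNr subrr.
Qed.

(* With the coefficients conjugated, sesquilinear forms in u and v become
   integrals of trigp u * conj (trigp v). *)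
Definition trigp n (u : 'cV[R[i]]_n) (t : R) : R[i] :=
  \sum_(j < n) conjc (u j 0) * expi (2 * pi * t) ^+ j.

Lemma ccontinuous_trigp n (u : 'cV[R[i]]_n) : ccontinuous (trigp u).
Proof.
apply: ccontinuous_sum => j; apply: ccontinuousM; first exact: ccontinuous_cst.
by apply: ccontinuousX; exact: ccontinuous_expi.
Qed.

Lemma Cintegral_trigp (nu : {measure set (measurableTypeR R) -> \bar R}) n
    (u v : 'cV[R[i]]_n) : (nu `[0%R, 1%R]%classic < +oo)%E ->
  Cintegral nu `[0, 1] (fun t => trigp u t * conjc (trigp v t)) =
  \sum_(j < n) \sum_(l < n) conjc (u j 0) *
    Cintegral nu `[0, 1]
      (fun t => expi (2 * pi * t) ^+ j * conjc (expi (2 * pi * t) ^+ l)) * v l 0.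
Proof.
move=> nufin.
have ce k : ccontinuous (fun t : R => expi (2 * pi * t) ^+ k).
  by apply: ccontinuousX; exact: ccontinuous_expi.
have cee j l : ccontinuous (fun t : R =>
    expi (2 * pi * t) ^+ j * conjc (expi (2 * pi * t) ^+ l)).
  by apply: ccontinuousM => //; apply: ccontinuous_conjc.
transitivity (Cintegral nu `[0, 1] (fun t : R => \sum_(j < n) \sum_(l < n)
    (conjc (u j 0) * v l 0) * (expi (2 * pi * t) ^+ j * conjc (expi (2 * pi * t) ^+ l)))).
  congr Cintegral; apply/funext => t; rewrite /trigp mulr_suml.
  apply: eq_bigr => j _; rewrite rmorph_sum mulr_sumr; apply: eq_bigr => l _.
  rewrite rmorphM/= conjcK; ring.
have ceeZ c j l : ccontinuous (fun t : R =>
    c * (expi (2 * pi * t) ^+ j * conjc (expi (2 * pi * t) ^+ l))).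
  by apply: ccontinuousM => //; exact: ccontinuous_cst.
rewrite Cintegral_sum//; last by move=> j; exact: ccontinuous_sum.
apply: eq_bigr => j _; rewrite Cintegral_sum//; apply: eq_bigr => l _.
by rewrite CintegralZl// mulrAC.
Qed.

(** Parseval: the Gram matrix of Lebesgue measure is the identity, exactly what the added 1 in the
    zeroth coefficient contributes to the Toeplitz matrix. *)
Lemma Cintegral_lebesgue_trigp n (u v : 'cV[R[i]]_n) :
  Cintegral (@lebesgue_measure R) `[0, 1] (fun t => trigp u t * conjc (trigp v t)) =
  \sum_(j < n) conjc (u j 0) * v j 0.
Proof.
rewrite Cintegral_trigp; last by rewrite /= lebesgue_measure_itv/= lte_fin ltr01 -EFinD ltry.
apply: eq_bigr => j _; rewrite (bigD1 j)//= big1 ?addr0 => [|l lj].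
  by rewrite Cintegral_expi eqxx mulr1.
by rewrite Cintegral_expi eq_sym val_eqE (negbTE lj) mulr0 mul0r.
Qed.

End trigonometric_polynomials.

(** * The Toeplitz form and the kernel *)

(** The expansion behind Cauchy-Schwarz; [s] is real, so conjugation leaves it alone. *)
Lemma sesquilinear_sub (R : realType) n (A : 'M[R[i]]_n) (v u : 'cV[R[i]]_n) (s : R) :
  let form (v w : 'cV[R[i]]_n) := ((map_mx conjc v)^T *m A *m w) 0 0 in
  forall a b c d, form v v = a -> form v u = b -> form u v = c -> form u u = d ->
  form (v - s%:C *: u) (v - s%:C *: u) = a - s%:C * b - s%:C * (c - s%:C * d).
Proof.
move=> form a b c d <- <- <- <-; have formL w : form (v - s%:C *: u) w = form v w - s%:C * form u w.
  rewrite /form (_ : (map_mx conjc _)^T = (map_mx conjc v)^T - s%:C *: (map_mx conjc u)^T).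
    by rewrite !mulmxBl -!scalemxAl [LHS]mxE [X in _ + X]mxE [X in _ - X]mxE.
  apply/matrixP => i j; rewrite !mxE [LHS]rmorphB [X in _ - X]rmorphM.
  by congr (_ - _ * _); exact: conjc_real.
have formR w : form w (v - s%:C *: u) = form w v - s%:C * form w u.
  by rewrite /form mulmxBr -scalemxAr [LHS]mxE [X in _ + X]mxE [X in _ - X]mxE.
by rewrite formL !formR.
Qed.

Section kernel_bounds.
Variables (R : realType) (mu : {measure set (measurableTypeR R) -> \bar R}) (N : nat).
Hypothesis mufin : (mu `[0%R, 1%R]%classic < +oo)%E.
Implicit Types u v : 'cV[R[i]]_N.+1.

Local Notation M := (modified_toeplitz (fourier_coef mu) N).
Local Notation form u v := (((map_mx conjc u)^T *m M *m v) 0 0).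

Lemma modified_coefE (j l : nat) :
  modified_coef (fourier_coef mu) (j%:Z - l%:Z) =
  Cintegral mu `[0, 1]
    (fun t => expi (2 * pi * t) ^+ j * conjc (expi (2 * pi * t) ^+ l)) + (j == l)%:R.
Proof.
have le_case (a b : nat) : (a <= b)%N -> fourier_coef mu (b - a) = Cintegral mu `[0, 1]
    (fun t => expi (2 * pi * t) ^+ b * conjc (expi (2 * pi * t) ^+ a)).
  move=> ab; congr Cintegral; apply/funext => t.
  by rewrite !expiX conj_expi -expiD natrB// mulrBr.
have [lj|jl] := leqP l j.
  rewrite subzn//= -le_case//.
  have [->|jl] := eqVneq j l; first by rewrite subnn eqxx.
  by rewrite subn_eq0 leqNgt ltn_neqAle eq_sym jl lj/= addr0.
(* The predecessor compensates the shift in [Negz]. *)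
have -> : j%:Z - l%:Z = Negz (l - j).-1.
  by rewrite NegzE prednK ?subn_gt0// -(subzn (ltnW jl)) opprB.
rewrite /modified_coef prednK ?subn_gt0// le_case ?(ltnW jl)// ltn_eqF// addr0.
rewrite -Cintegral_conjc//; last first.
  by apply: ccontinuousM; last apply: ccontinuous_conjc;
    apply: ccontinuousX; exact: ccontinuous_expi.
by congr Cintegral; apply/funext => t; rewrite rmorphM/= conjcK mulrC.
Qed.

(** The form is the inner product of [trigp u] and [trigp v] in L^2 of mu plus Lebesgue measure; the
    Lebesgue part is written through the coefficients. *)
Lemma toeplitz_formE u v : form u v =
  Cintegral mu `[0, 1] (fun t => trigp u t * conjc (trigp v t)) +
  \sum_j conjc (u j 0) * v j 0.
Proof.
rewrite Cintegral_trigp// -big_split/= mxE.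
under [LHS]eq_bigr do rewrite mxE mulr_suml.
rewrite [LHS]exchange_big/=; apply: eq_bigr => j _.
transitivity (\sum_(l < N.+1) (conjc (u j 0) * Cintegral mu `[0, 1]
      (fun t => expi (2 * pi * t) ^+ j * conjc (expi (2 * pi * t) ^+ l)) * v l 0 +
    (if l == j then conjc (u j 0) * v l 0 else 0))).
  apply: eq_bigr => l _; rewrite !mxE modified_coefE mulrDr mulrDl eq_sym val_eqE.
  by case: eqP => _; rewrite ?mulr1// mulr0 mul0r.
by rewrite big_split/= -big_mkcond big_pred1_eq.
Qed.

Lemma toeplitz_form_conjc u v : form v u = conjc (form u v).
Proof.
rewrite !toeplitz_formE.
have -> (a b : R[i]) : conjc (a + b) = conjc a + conjc b by exact: rmorphD.
rewrite -Cintegral_conjc//; last first.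
  by apply: ccontinuousM; last apply: ccontinuous_conjc; exact: ccontinuous_trigp.
congr (_ + _).
  by congr Cintegral; apply/funext => t; rewrite rmorphM/= conjcK mulrC.
rewrite [RHS]rmorph_sum; apply: eq_bigr => j _.
by rewrite rmorphM/= conjcK mulrC.
Qed.

Definition toeplitz_sqnorm u : R :=
  \int[mu]_(t in `[0, 1]) sqnormc (trigp u t) + \sum_j sqnormc (u j 0).

Lemma toeplitz_form_sqnorm u : form u u = (toeplitz_sqnorm u)%:C.
Proof.
rewrite toeplitz_formE rmorphD rmorph_sum/= -Cintegral_real; congr (_ + _).
  by congr Cintegral; apply/funext => t; rewrite mulc_conjc.
by apply: eq_bigr => j _; rewrite mulrC mulc_conjc.
Qed.

(** The coefficient sum, that is the Lebesgue part, is already positive, whatever mu is. *)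
Lemma toeplitz_sqnorm_gt0 u : u != 0 -> 0 < toeplitz_sqnorm u.
Proof.
move=> u0; rewrite ltr_wpDl//.
  by apply: Rintegral_ge0 => t _; exact: sqnormc_ge0.
have [j uj] : exists j, u j 0 != 0.
  apply/existsP; move: u0; apply: contraNT => /existsPn uj.
  by apply/eqP/colP => j; rewrite mxE; apply/eqP; rewrite -[_ == _]negbK uj.
rewrite (bigD1 j)//= ltr_pwDl//; first by rewrite lt_def sqnormc_eq0 uj sqnormc_ge0.
by apply: sumr_ge0 => i _; exact: sqnormc_ge0.
Qed.

Lemma toeplitz_sqnorm_ge0 u : 0 <= toeplitz_sqnorm u.
Proof.
rewrite addr_ge0//; first by apply: Rintegral_ge0 => t _; exact: sqnormc_ge0.
by apply: sumr_ge0 => i _; exact: sqnormc_ge0.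
Qed.

(** If a row [v] is killed by the matrix, the Hermitian transpose of [v] has norm zero for the form,
    hence vanishes. *)
Lemma modified_toeplitz_unit : M \in unitmx.
Proof.
rewrite -row_free_unit; apply: inj_row_free => v vM0.
apply/eqP; apply: contraT => v0.
pose u := (map_mx conjc v)^T.
have u0 : u != 0.
  apply: contra v0 => /eqP uv; apply/eqP/rowP => j.
  have /matrixP/(_ j 0) := uv; rewrite !mxE => vj.
  by rewrite -[v 0 j]conjcK vj rmorph0.
have := toeplitz_sqnorm_gt0 u0.
suff : (toeplitz_sqnorm u)%:C = 0 by case=> ->; rewrite ltxx.
rewrite -toeplitz_form_sqnorm (_ : (map_mx conjc u)^T = v) ?vM0 ?mul0mx ?mxE//.
by apply/matrixP => i j; rewrite !mxE conjcK.
Qed.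

Variable x : R.
Local Notation z := (expi (2 * pi * x)).

Lemma trigp_monomials t : sqnormc (trigp (monomials N z) t) = fejer x N t * N.+1%:R.
Proof.
rewrite /fejer divfK ?pnatr_eq0//; congr sqnormc; apply: eq_bigr => j _.
rewrite mxE (_ : conjc (z ^+ j) = conjc z ^+ j); last exact: rmorphXn.
by rewrite conj_expi -exprMn -expiD; congr (expi _ ^+ _); ring.
Qed.

Lemma sum_sqnormc_monomials : \sum_j sqnormc (monomials N z j 0) = N.+1%:R.
Proof.
under eq_bigr do rewrite mxE expiX sqnormc_expi.
by rewrite sumr_const card_ord.
Qed.

(** The coordinates of the representer of evaluation at [x]: [form kernel_coords v] is the conjugate
    of [trigp v x]. *)
Definition kernel_coords : 'cV[R[i]]_N.+1 := invmx M *m monomials N z.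

(** Since M u = psi, the kernel psi^H M^-1 psi is u^H M u, the squared norm of the representer. The
    form at (psi, u) is psi^H psi = N + 1, which Cauchy-Schwarz turns into the last clause, the
    source of the upper bound; the third clause feeds the lower bound. *)
Lemma kernel_coordsP : let u := kernel_coords in
  [/\ 0 < toeplitz_sqnorm u,
      modified_kernel (fourier_coef mu) N z z = (toeplitz_sqnorm u)%:C,
      \sum_j conjc (u j 0) * monomials N z j 0 = (toeplitz_sqnorm u)%:C &
      N.+1%:R ^+ 2 <= toeplitz_sqnorm (monomials N z) * toeplitz_sqnorm u].
Proof.
move=> u; set psi := monomials N z.
have Mu : M *m u = psi by rewrite mulKVmx// modified_toeplitz_unit.
have u0 : u != 0.
  apply/eqP => u0; move: Mu; rewrite u0 mulmx0 => /matrixP/(_ 0 0).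
  by rewrite !mxE expr0 => /eqP; rewrite eq_sym oner_eq0.
have k0 := toeplitz_sqnorm_gt0 u0.
have uPsi : (map_mx conjc u)^T *m psi = (toeplitz_sqnorm u)%:C%:M.
  by rewrite -{1}Mu mulmxA [LHS]mx11_scalar toeplitz_form_sqnorm.
have psiPsi : (map_mx conjc psi)^T *m psi = (N.+1%:R : R[i])%:M.
  rewrite [LHS]mx11_scalar mxE; congr (_%:M).
  under eq_bigr do rewrite !mxE mulrC -[conjc _]/(conjc _) mulc_conjc expiX sqnormc_expi.
  by rewrite sumr_const card_ord.
split => //.
- rewrite /modified_kernel -/psi -mulmxA -/u mxE.
  have /matrixP/(_ 0 0) := uPsi; rewrite !mxE eqxx mulr1n => /(congr1 conjc).
  rewrite [RHS]conjc_real => <-; rewrite rmorph_sum; apply: eq_bigr => j _.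
  by rewrite !mxE rmorphM/= conjcK mulrC.
- have /matrixP/(_ 0 0) := uPsi; rewrite !mxE eqxx mulr1n => <-.
  by apply: eq_bigr => j _; rewrite !mxE.
pose k := toeplitz_sqnorm u; pose s : R := N.+1%:R / k.
have formPsi : form psi u = N.+1%:R.
  by rewrite -mulmxA Mu psiPsi mxE eqxx mulr1n.
have formuPsi : form u psi = N.+1%:R.
  by rewrite toeplitz_form_conjc formPsi rmorph_nat.
(* Cauchy-Schwarz: s minimizes the norm of psi - s u. *)
have : toeplitz_sqnorm (psi - s%:C *: u) =
    toeplitz_sqnorm psi - s * N.+1%:R - s * (N.+1%:R - s * k).
  apply: (@complexI R).
  have E := @sesquilinear_sub R _ M psi u s _ _ _ _ (toeplitz_form_sqnorm psi)
    formPsi formuPsi (toeplitz_form_sqnorm u).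
  transitivity (form (psi - s%:C *: u) (psi - s%:C *: u)).
    by rewrite toeplitz_form_sqnorm.
  apply: (etrans E); rewrite -/k.
  have -> : (N.+1%:R : R[i]) = (N.+1%:R : R)%:C by rewrite rmorph_nat.
  by rewrite -!(rmorphM, rmorphB).
have := toeplitz_sqnorm_ge0 (psi - s%:C *: u) => /[swap] ->.
rewrite /s divfK ?gt_eqF// subrr mulr0 subr0 subr_ge0 mulrAC ler_pdivrMr//.
Qed.

End kernel_bounds.

(** * The absolutely continuous part *)

Lemma has_density01_RN (R : realType)
    (nu : {measure set (measurableTypeR R) -> \bar R}) (rho : R -> R) :
  (nu setT < +oo)%E -> has_density01 nu rho ->
  exists h : R -> R, [/\ forall t, 0 <= h t,
    (@lebesgue_measure R).-integrable setT (EFin \o h),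
    {ae @lebesgue_measure R, forall t : R, t \in `[0, 1] -> rho t = h t} &
    forall f : R -> R, (forall t, 0 <= f t) -> measurable_fun setT f ->
      (\int[nu]_(t in `[0%R, 1%R]) (f t)%:E)%E =
      (\int[@lebesgue_measure R]_(t in `[0%R, 1%R]) (f t * h t)%:E)%E].
Proof.
move=> nufin [irho nurho].
have nu_fin : fin_num_fun nu by exact: lty_fin_num_fun.
have nu_sigma_finite : sigma_finite setT nu.
  by apply: fin_num_fun_sigma_finite; rewrite ?measure0.
pose H1 := isFinite.Build _ _ _ _ nu_fin.
pose H2 := isSFinite.Build _ _ _ _ (sfinite_measure_sigma_finite nu_sigma_finite).
pose H3 := isSigmaFinite.Build _ _ _ _ nu_sigma_finite.
(* [nu'] is [nu] itself, equipped with the structure that the Radon-Nikodym derivative asks for. *)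
pose nu' : {finite_measure set (measurableTypeR R) -> \bar R} :=
  HB.pack_for (FiniteMeasure.type (measurableTypeR R) R) (Measure.sort nu) H1 H2 H3.
have dom : nu' `<< @lebesgue_measure R.
  apply/null_content_dominatesP => A mA A0.
  change (nu A = 0%E).
  rewrite nurho//; apply: null_set_integral.
  - by apply: measurableI.
  - by apply: measurable_funS (measurable_int _ irho) => //; exact: subIsetr.
  - apply: (subset_measure0 _ mA _ A0); last exact: subIsetl.
    by apply: measurableI.
pose h0 := Radon_Nikodym_SigmaFinite.f nu' (@lebesgue_measure R).
have h0E t : h0 t = (fine (h0 t))%:E.
  by rewrite fineK//; exact: Radon_Nikodym_SigmaFinite.f_fin_num.
have ih0 := Radon_Nikodym_SigmaFinite.f_integrable dom.
exists (fine \o h0); split.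
- by move=> t; apply: fine_ge0; exact: Radon_Nikodym_SigmaFinite.f_ge0.
- by rewrite (_ : EFin \o _ = h0)//; apply/funext => t; rewrite /= -h0E.
- have := @integral_ae_eq _ (measurableTypeR R) R (@lebesgue_measure R)
    `[0, 1]%classic _ h0 (EFin \o rho) irho.
  case=> //.
  + by apply: measurable_funTS; exact: measurable_int ih0.
  + move=> E E01 mE; rewrite -Radon_Nikodym_SigmaFinite.f_integral//.
    rewrite -[RHS]/(nu E) nurho//; congr (integral _ _ _).
    by rewrite setIidl.
  + move=> A [mA A0 sA]; exists A; split => //; apply: subset_trans sA => t.
    apply: contra_not => /= tr t01; have := tr t01.
    by rewrite h0E => -[].
- move=> f f0 mf.
  transitivity (\int[@lebesgue_measure R]_(t in `[0%R, 1%R]) ((f t)%:E * h0 t))%E.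
    apply/esym/(Radon_Nikodym_SigmaFinite.change_of_variables dom) => //.
    by apply: measurable_funTS; apply/measurable_EFinP.
  by apply: eq_integral => t _; rewrite EFinM -h0E.
Qed.

(** * Fejer means *)

Section fejer_means.
Variable R : realType.
Local Notation la := (@lebesgue_measure R).

Lemma lebesgue01_lty : (la `[0%R, 1%R]%classic < +oo)%E.
Proof. by rewrite /= lebesgue_measure_itv/= lte_fin ltr01 -EFinD ltry. Qed.

Lemma continuous_fejer x N : continuous (fejer x N : R -> R).
Proof.
have -> : fejer x N = fun t => sqnormc (trigp (monomials N (expi (2 * pi * x))) t) / N.+1%:R.
  by apply/funext => t; rewrite trigp_monomials mulfK ?pnatr_eq0.
move=> t; apply: cvgM; last exact: cvg_cst.
by apply: continuous_sqnormc; exact: ccontinuous_trigp.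
Qed.

Lemma Rintegral_sqnormc_trigp n (u : 'cV[R[i]]_n) :
  \int[la]_(t in `[0, 1]) sqnormc (trigp u t) = \sum_j sqnormc (u j 0).
Proof.
apply: (@complexI R); rewrite -Cintegral_real rmorph_sum/=.
transitivity (Cintegral la `[0, 1] (fun t => trigp u t * conjc (trigp u t))).
  by congr Cintegral; apply/funext => t; rewrite mulc_conjc.
rewrite Cintegral_lebesgue_trigp; apply: eq_bigr => j _.
by rewrite mulrC mulc_conjc.
Qed.

(** Parseval for a vector of [N.+1] coefficients of modulus 1. *)
Lemma Rintegral_fejer x N : \int[la]_(t in `[0, 1]) fejer x N t = 1.
Proof.
have := Rintegral_sqnormc_trigp (monomials N (expi (2 * pi * x))).
rewrite sum_sqnormc_monomials.
under eq_Rintegral do rewrite trigp_monomials.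
rewrite RintegralZr//; last exact/continuous_integrable01/continuous_fejer/lebesgue01_lty.
by move/eqP; rewrite -[X in _ == X]mul1r => /eqP/mulIf; apply; rewrite pnatr_eq0.
Qed.

(** Uses that the Fejer kernel has mass 1. Both bounds go through it with [g] the distance of [h] to
    its value at [x]: the upper one with [f] equal to [h], the lower one with [f] equal to 1 / (1 +
    h). *)
Lemma integral_fejerD_le (g f : R -> R) (x a e : R) N : 0 <= a ->
  measurable_fun setT g -> measurable_fun setT f ->
  (forall t, 0 <= f t) -> (forall t, 0 <= g t) -> (forall t, f t <= a + g t) ->
  (\int[la]_(t in `[0%R, 1%R]) (fejer x N t * g t)%:E <= e%:E)%E ->
  (\int[la]_(t in `[0%R, 1%R]) (fejer x N t * f t)%:E <= (a + e)%:E)%E.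
Proof.
move=> a0 mg mf f0 g0 fg ge.
have mF : measurable_fun setT (fejer x N).
  by apply: continuous_measurable_fun; exact: continuous_fejer.
have iF : (\int[la]_(t in `[0%R, 1%R]) (fejer x N t)%:E)%E = 1%E.
  have F1 := Rintegral_fejer x N; rewrite /Rintegral in F1.
  rewrite -[LHS]fineK ?F1//; apply: integrable_fin_num => //.
  exact/continuous_integrable01/continuous_fejer/lebesgue01_lty.
apply: (@le_trans _ _ (\int[la]_(t in `[0%R, 1%R])
    (a%:E * (fejer x N t)%:E + (fejer x N t * g t)%:E))%E).
  apply: ge0_le_integral => //.
  - by move=> t _; rewrite lee_fin mulr_ge0 ?fejer_ge0.
  - by apply: measurable_funTS; apply/measurable_EFinP; exact: measurable_funM.
  - apply: emeasurable_funD; apply: measurable_funTS.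
      by apply/measurable_EFinP; exact: measurable_funM.
    by apply/measurable_EFinP; exact: measurable_funM.
  - move=> t _; rewrite -EFinM -EFinD lee_fin [a * _]mulrC -mulrDr.
    by rewrite ler_wpM2l ?fejer_ge0.
rewrite ge0_integralD//.
- rewrite ge0_integralZl//.
  + by rewrite iF mule1 EFinD leeD2l.
  + by apply: measurable_funTS; apply/measurable_EFinP.
  + by move=> t _; rewrite lee_fin fejer_ge0.
- by move=> t _; rewrite lee_fin mulr_ge0 ?fejer_ge0.
- by apply: measurable_funTS; apply/measurable_EFinP; exact: measurable_funM.
- by move=> t _; rewrite lee_fin mulr_ge0 ?fejer_ge0.
- by apply: measurable_funTS; apply/measurable_EFinP; exact: measurable_funM.
Qed.

Lemma measurable_inv1D (h : R -> R) : (forall t, 0 <= h t) ->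
  measurable_fun setT h -> measurable_fun setT (fun t => (1 + h t)^-1).
Proof.
move=> h0 mh.
(* The absolute value keeps the denominator away from 0 on the whole line, so the outer function is
   continuous. *)
have -> : (fun t => (1 + h t)^-1) = (fun y : R => (1 + `|y|)^-1) \o h.
  by apply/funext => t /=; rewrite ger0_norm.
apply: measurableT_comp => //; apply: continuous_measurable_fun => y.
apply: cvgV; first by rewrite gt_eqF// ltr_pwDl.
by apply: cvgD; [exact: cvg_cst|exact: norm_continuous].
Qed.

Lemma inv1D_dist_le (a b : R) : 0 <= a -> 0 <= b ->
  (1 + a)^-1 <= (1 + b)^-1 + `|a - b|.
Proof.
move=> a0 b0; have A0 : 0 < 1 + a by rewrite ltr_pwDl.
have B0 : 0 < 1 + b by rewrite ltr_pwDl.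
rewrite -lerBlDl (_ : _ - _ = (b - a) / ((1 + a) * (1 + b))); last first.
  by field; rewrite !gt_eqF.
rewrite ler_pdivrMr ?mulr_gt0// distrC (le_trans (ler_norm _))//.
by rewrite ler_peMr// -[leLHS]mulr1 ler_pM// lerDl.
Qed.

(* With p = trigp u and q = trigp (monomials N z), the value of the kernel is
   \int p conj(q), and 2 Re (p conj(q)) <= |p|^2 (1 + h) + |q|^2 / (1 + h); the
   first term integrates to at most the value of the kernel itself. *)
Lemma kernel_le_fejer_mean (mu : {measure set (measurableTypeR R) -> \bar R})
    (h : R -> R) (x : R) N (u : 'cV[R[i]]_N.+1) :
  (mu `[0%R, 1%R]%classic < +oo)%E ->
  (forall t, 0 <= h t) -> measurable_fun setT h ->
  (forall f : R -> R, (forall t, 0 <= f t) -> measurable_fun setT f ->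
     (\int[la]_(t in `[0%R, 1%R]) (f t * h t)%:E <=
      \int[mu]_(t in `[0%R, 1%R]) (f t)%:E)%E) ->
  \sum_j conjc (u j 0) * monomials N (expi (2 * pi * x)) j 0 = (toeplitz_sqnorm mu u)%:C ->
  ((toeplitz_sqnorm mu u / N.+1%:R)%:E <=
    \int[la]_(t in `[0%R, 1%R]) (fejer x N t * (1 + h t)^-1)%:E)%E.
Proof.
move=> mufin h0 mh hmu uPsi.
set k := toeplitz_sqnorm mu u; set psi := monomials N (expi (2 * pi * x)).
have W0 t : 0 < 1 + h t by rewrite ltr_pwDl.
have cp := ccontinuous_trigp u; have cq := ccontinuous_trigp psi.
have csp := continuous_sqnormc cp; have csq := continuous_sqnormc cq.
have msp : measurable_fun setT (fun t => sqnormc (trigp u t)).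
  exact: continuous_measurable_fun.
have msq : measurable_fun setT (fun t => sqnormc (trigp psi t)).
  exact: continuous_measurable_fun.
have mW : measurable_fun setT (fun t => (1 + h t)^-1) by exact: measurable_inv1D.
have [crpq _] := ccontinuousM cp (ccontinuous_conjc cq).
have ipq : la.-integrable `[0, 1] (EFin \o (fun t =>
    2 * complex.Re (trigp u t * conjc (trigp psi t)))).
  apply: continuous_integrable01; first exact: lebesgue01_lty.
  by move=> t; apply: cvgM; [exact: cvg_cst|exact: crpq].
have ip : la.-integrable `[0, 1] (EFin \o (fun t => sqnormc (trigp u t))).
  by apply: continuous_integrable01 => //; exact: lebesgue01_lty.
have imup : mu.-integrable `[0, 1] (EFin \o (fun t => sqnormc (trigp u t))).
  exact: continuous_integrable01.
(* Integrability comes from domination by [mu], for which the continuous function |p|^2 is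
   integrable. *)
have iph : la.-integrable `[0, 1] (EFin \o (fun t => sqnormc (trigp u t) * h t)).
  apply/integrableP; split.
    by apply: measurable_funTS; apply/measurable_EFinP; exact: measurable_funM.
  under eq_integral do rewrite gee0_abs ?lee_fin ?mulr_ge0 ?sqnormc_ge0//.
  apply: le_lt_trans (hmu _ _ _) _ => //; first by move=> t; exact: sqnormc_ge0.
  case/integrableP : imup => _; apply: le_lt_trans.
  by under [leRHS]eq_integral do rewrite gee0_abs ?lee_fin ?sqnormc_ge0//.
have iq : la.-integrable `[0, 1] (EFin \o (fun t => sqnormc (trigp psi t))).
  by apply: continuous_integrable01 => //; exact: lebesgue01_lty.
have iqW : la.-integrable `[0, 1] (EFin \o (fun t => sqnormc (trigp psi t) * (1 + h t)^-1)).
  apply: (le_integrable _ _ _ iq) => //.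
    by apply: measurable_funTS; apply/measurable_EFinP; exact: measurable_funM.
  move=> t _ /=; rewrite lee_fin normrM ler_piMr// ger0_norm ?invr_ge0 ?(ltW (W0 t))//.
  by rewrite invf_le1// lerDl.
have E1 : \int[la]_(t in `[0, 1]) (2 * complex.Re (trigp u t * conjc (trigp psi t))) = 2 * k.
  rewrite RintegralZl//; last by apply: continuous_integrable01 => //; exact: lebesgue01_lty.
  congr (_ * _); have := Cintegral_lebesgue_trigp u psi.
  by rewrite uPsi /Cintegral => -[].
have E2 : 2 * k <= k + \int[la]_(t in `[0, 1]) (sqnormc (trigp psi t) * (1 + h t)^-1).
  rewrite -{1}E1.
  apply: (@le_trans _ _ (\int[la]_(t in `[0, 1])
      (sqnormc (trigp u t) + sqnormc (trigp u t) * h t +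
       sqnormc (trigp psi t) * (1 + h t)^-1))).
    apply: le_Rintegral => //.
      have := integrableD _ (integrableD _ ip iph) iqW; exact.
    move=> t _.
    have := W0 t; move: (h t) (trigp u t) (trigp psi t) => w [a b] [c d] W.
    rewrite /sqnormc; simpc => /=.
    rewrite -subr_ge0.
    (* The gap in the pointwise inequality is |p (1 + w) - q|^2 / (1 + w). *)
    have -> : a ^+ 2 + b ^+ 2 + (a ^+ 2 + b ^+ 2) * w + (c ^+ 2 + d ^+ 2) * (1 + w)^-1 -
        2 * (a * c + b * d) =
        ((a * (1 + w) - c) ^+ 2 + (b * (1 + w) - d) ^+ 2) / (1 + w).
      by field; rewrite gt_eqF.
    by rewrite divr_ge0 ?(ltW W)// addr_ge0// sqr_ge0.
  have isum : la.-integrable `[0, 1] (EFin \o (fun t => sqnormc (trigp u t) +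
      sqnormc (trigp u t) * h t)) by have := integrableD _ ip iph; exact.
  rewrite RintegralD//.
  (* By Parseval the unweighted term is the coefficient sum contained in [k]; it remains to compare
     the integral of |p|^2 h with that of |p|^2 against [mu]. *)
  rewrite RintegralD// lerD2r Rintegral_sqnormc_trigp addrC lerD2r.
  apply: fine_le.
  - exact: integrable_fin_num.
  - exact: integrable_fin_num.
  - by apply: hmu => // t; exact: sqnormc_ge0.
have -> : (\int[la]_(t in `[0%R, 1%R]) (fejer x N t * (1 + h t)^-1)%:E)%E =
    (\int[la]_(t in `[0, 1]) (N.+1%:R^-1 * (sqnormc (trigp psi t) * (1 + h t)^-1)))%:E.
  rewrite /Rintegral fineK; last first.
    apply: integrable_fin_num => //=.
    exact: (integrableZl _ _ iqW).
  apply: eq_integral => t _; rewrite trigp_monomials; congr (_%:E).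
  by rewrite [fejer _ _ _ * _%:R]mulrC !mulrA mulVf ?mul1r ?pnatr_eq0.
rewrite RintegralZl// lee_fin mulrC ler_wpM2l ?invr_ge0//; lra.
Qed.

End fejer_means.

(** * Convergence at almost every point *)

Lemma fejer_mean_cvg0 (R : realType)
    (nu : {measure set (measurableTypeR R) -> \bar R}) (g : R -> R) (x : R) :
  0 < x < 1 -> measurable_fun setT g -> (forall t, 0 <= g t) ->
  (\int[nu]_(t in `[0%R, 1%R]) (g t)%:E < +oo)%E ->
  (forall e, 0 < e -> exists2 d, 0 < d & forall r, 0 < r -> r < d ->
     (\int[nu]_(t in `[0%R, 1%R] `&` ball x r) (g t)%:E <= (e * r)%:E)%E) ->
  forall e, 0 < e -> \forall N \near \oo,
    (\int[nu]_(t in `[0%R, 1%R]) (fejer x N t * g t)%:E <= e%:E)%E.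
Proof.
move=> x01 mg g0 gfin gx.
have [C Cx] := fejer_decay x01.
apply: (@approximate_identity_cvg0 R nu `[0, 1]%classic x (fejer x) g (Num.max 2 C)) => //.
- move=> N; apply: measurable_funTS.
  by apply: continuous_measurable_fun; exact: continuous_fejer.
- exact: measurable_funTS.
- move=> N t _; rewrite fejer_ge0/= (le_trans (fejer_le _ _ _))//.
  by rewrite ler_wpM2r// le_max lexx.
- move=> N t /=; rewrite in_itv/= => t01.
  by rewrite (le_trans (Cx N t t01))// le_max lexx orbT.
Qed.

Lemma lebesgue_pt_integral_le (R : realType) (h : R -> R) (x : R) :
  measurable_fun setT h -> lebesgue_pt h x ->
  forall e, 0 < e -> exists2 d, 0 < d & forall r, 0 < r -> r < d ->
    (\int[@lebesgue_measure R]_(t in `[0%R, 1%R] `&` ball x r) `|h t - h x|%:E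
      <= (e * r)%:E)%E.
Proof.
move=> mh hx e e0.
(* The average is taken over a ball of length [2 * r], hence the halved threshold. *)
have : nbhs (0%R : \bar R)%E [set y : \bar R | (y < (e / 2)%:E)%E].
  apply: open_nbhs_nbhs; split; first exact: open_ereal_lt_ereal.
  by rewrite /= lte_fin divr_gt0.
move=> /hx [d /= d0 dP]; exists d => // r r0 rd.
have /dP/(_ r0)/ltW : ball_ Num.norm 0 d r by rewrite /= sub0r normrN gtr0_norm.
rewrite /davg /iavg lebesgue_measure_ball ?(ltW r0)// inver.
rewrite mulrn_eq0/= gt_eqF// lee_pdivrMl ?mulrn_wgt0// => H.
apply: (@le_trans _ _ (\int[@lebesgue_measure R]_(t in ball x r) `|h t - h x|%:E)%E).
  apply: ge0_subset_integral => //.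
  - by apply: measurableI => //; exact: measurable_ball.
  - exact: measurable_ball.
  - apply: measurable_funTS; apply/measurable_EFinP; apply: measurableT_comp => //.
    exact: measurable_funB.
apply: le_trans H _; rewrite -EFinM lee_fin -mulr_natl; lra.
Qed.

(** Inverting the second bound gives a >= w / (1 + e w) >= w - w^2 e. The 3 in the first bound
    counts one error for each of the atomic, absolutely continuous and singular parts. *)
Lemma mean_bounds_dist_le (R : realType) (a w e : R) : 0 < a -> 1 <= w -> 0 <= e ->
  a <= w + 3 * e -> a^-1 <= w^-1 + e -> `|w - a| <= (3 + w ^+ 2) * e.
Proof.
move=> a0 w1 e0 aw wa; have w0 : 0 < w by exact: lt_le_trans w1.
have h : 1 <= a * (w^-1 + e) by rewrite -ler_pdivrMl// mulr1.
have h2 : w <= a * (1 + e * w).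
  by move: h; rewrite -(ler_pM2l w0) mulr1 mulrCA mulrDr divff ?gt_eqF// [w * e]mulrC.
have e1 : 0 < 1 + e * w by rewrite ltr_pwDl// mulr_ge0// ltW.
have h3 : w - w ^+ 2 * e <= a.
  rewrite -(ler_pM2r e1); apply: le_trans h2.
  rewrite -subr_ge0 (_ : _ - _ = w ^+ 3 * e ^+ 2); last ring.
  by rewrite mulr_ge0// exprn_ge0// ltW.
have q : 0 <= w ^+ 2 * e by rewrite mulr_ge0// exprn_ge0// ltW.
rewrite ler_norml; apply/andP; split; lra.
Qed.

Lemma cvg_realc (R : realType) (u : nat -> R) (l : R) :
  (forall e, 0 < e -> \forall n \near \oo, `|l - u n| <= e) ->
  (fun n => (u n)%:C : R[i]^o) @ \oo --> (l%:C : R[i]^o).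
Proof.
(* A positive element of [R[i]] has zero imaginary part, so the tolerance is in fact a real number
   [a]. *)
move=> ul; apply/cvgrPdist_le => /= -[a b]; rewrite ltcE/= => /andP[/eqP b0 a0].
have := ul a a0; apply: filterS => n.
rewrite -rmorphB/= normc_def/= expr0n addr0 sqrtr_sqr lecE/= -b0 eqxx => ->.
by [].
Qed.

Unset Implicit Arguments.

Theorem theorem2 (R : realType)
    (mu : {finite_measure set (measurableTypeR R) -> \bar R})
    (mu_at mu_ac mu_sc : {measure set (measurableTypeR R) -> \bar R})
    (rho : R -> R)
    (mu_supp : mu (~` `[0, 1]) = 0%E)
    (mu_decomp : forall D : set (measurableTypeR R), measurable D ->
       mu D = (mu_at D + mu_ac D + mu_sc D)%E)
    (at_atomic : atomic mu_at)
    (ac_density : has_density01 mu_ac rho)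
    (sc_singular : singular_continuous mu_sc) :
  {ae @lebesgue_measure R, forall theta : R, theta \in `[0, 1] ->
     (fun N : nat =>
        (N.+1%:R / modified_kernel (fourier_coef mu) N
                     (expi (2 * pi * theta)) (expi (2 * pi * theta)) - 1)
        : R[i]^o) @ \oo --> ((rho theta)%:C : R[i]^o)}.
Proof.
have mu_lty : (mu setT < +oo)%E by exact: fin_num_fun_lty.
have muT := mu_decomp setT measurableT.
have at_lty : (mu_at setT < +oo)%E.
  by apply: le_lt_trans mu_lty; rewrite muT -addeA leeDl// adde_ge0.
have ac_lty : (mu_ac setT < +oo)%E.
  by apply: le_lt_trans mu_lty; rewrite muT [(mu_at _ + _)%E]addeC -addeA leeDl// adde_ge0.
have sc_lty : (mu_sc setT < +oo)%E.
  by apply: le_lt_trans mu_lty; rewrite muT leeDr// adde_ge0.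
have lty01 (nu : {measure set (measurableTypeR R) -> \bar R}) :
    (nu setT < +oo)%E -> (nu `[0%R, 1%R]%classic < +oo)%E.
  by apply: le_lt_trans; rewrite le_measure// inE.
have mu01_lty := lty01 mu mu_lty.
have mu_integral (f : R -> R) : (forall t, 0 <= f t) -> measurable_fun setT f ->
    (\int[mu]_(t in `[0%R, 1%R]) (f t)%:E =
     \int[mu_at]_(t in `[0%R, 1%R]) (f t)%:E +
     \int[mu_ac]_(t in `[0%R, 1%R]) (f t)%:E +
     \int[mu_sc]_(t in `[0%R, 1%R]) (f t)%:E)%E.
  move=> f0 mf.
  rewrite (eq_measure_integral (measure_add (measure_add mu_at mu_ac) mu_sc)); last first.
    move=> A mA _; apply: etrans (mu_decomp _ mA) _.
    apply/esym/(etrans (measure_addE _ _ _)); congr (_ + _)%E.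
    exact: measure_addE.
  have mfE : measurable_fun (`[0%R, 1%R]%classic : set (measurableTypeR R)) (EFin \o f).
    by apply: measurable_funTS; apply/measurable_EFinP.
  by rewrite !ge0_integral_measure_add//; move=> t _; rewrite lee_fin.
have [h [h0 ih rhoh hE]] := has_density01_RN ac_lty ac_density.
have mh : measurable_fun setT h by apply/measurable_EFinP; exact: measurable_int ih.
have h_pt := lebesgue_differentiation (open_integrable_locally openT ih).
have [A cA at0] := at_atomic.
(* A countable carrier is Lebesgue-null, so the atomic part is differentiated as a singular
   measure. *)
have at_der := singular_measure_derivative at_lty (countable_measurable (@measurable_set1 R) cA)
  (countable_lebesgue_measure0 cA) at0.
have [_ [B [mB B0 sc0]]] := sc_singular.
have sc_der := singular_measure_derivative sc_lty mB B0 sc0.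
(* The decay of the Fejer kernel is available only at interior points. *)
have ends : {ae @lebesgue_measure R, forall t : R, t != 0 /\ t != 1}.
  exists [set 0; 1]; split => //.
  - by apply: measurableU; exact: measurable_set1.
  - by apply: countable_lebesgue_measure0; apply: finite_set_countable.
  - by move=> t /= /not_andP[] /negP; rewrite negbK => /eqP ->; [left|right].
have ae_filter := ae_filter_ringOfSetsType (@lebesgue_measure R).
apply: filterS (filterI h_pt (filterI at_der (filterI sc_der (filterI ends rhoh)))).
move=> x [hx [atx [scx [[x0 x1] rx]]]] x01; rewrite (rx x01).
have {}x01 : 0 < x < 1.
  by move: x01; rewrite in_itv/= !le_eqVlt eq_sym (negbTE x0) (negbTE x1).
have sing_cvg (nu : {measure set (measurableTypeR R) -> \bar R}) :
    (nu setT < +oo)%E ->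
    (forall e, 0 < e -> exists2 d, 0 < d & forall r, 0 < r -> r < d ->
       (nu (ball x r) <= (e * r)%:E)%E) ->
    forall e, 0 < e -> \forall N \near \oo,
      (\int[nu]_(t in `[0%R, 1%R]) (fejer x N t)%:E <= e%:E)%E.
  move=> nufin nux e e0.
  have int1 D : measurable D -> (\int[nu]_(t in D) 1%:E)%E = nu D.
    by move=> mD; rewrite integral_cst// mul1e.
  have := @fejer_mean_cvg0 R nu (fun=> 1) x x01 (measurable_cst _) (fun=> ler01).
  rewrite int1// => /(_ (lty01 _ nufin)); case/(_ _ e e0) => [e' e'0|].
    have [d d0 dP] := nux e' e'0; exists d => // r r0 rd.
    rewrite int1; last by apply: measurableI => //; exact: measurable_ball.
    apply: le_trans (dP r r0 rd); apply: le_measure; rewrite ?inE.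
    - by apply: measurableI => //; exact: measurable_ball.
    - exact: measurable_ball.
    - exact: subIsetr.
  move=> N _ HN; exists N => // n Nn; have := HN n Nn => /=.
  by under eq_integral do rewrite mulr1.
have h_cvg e : 0 < e -> \forall N \near \oo,
    (\int[@lebesgue_measure R]_(t in `[0%R, 1%R]) (fejer x N t * `|h t - h x|)%:E <= e%:E)%E.
  apply: fejer_mean_cvg0 => //.
  - by apply: measurableT_comp => //; exact: measurable_funB.
  - have icst : (@lebesgue_measure R).-integrable `[0, 1] (EFin \o fun=> h x).
      by apply: continuous_integrable01; [exact: lebesgue01_lty|exact: cst_continuous].
    have ih01 : (@lebesgue_measure R).-integrable `[0, 1] (EFin \o h).
      exact: integrableS ih.
    have m01 : measurable (`[0%R, 1%R]%classic : set (measurableTypeR R)).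
      exact: measurable_itv.
    by have /integrableP[_] := integrableB m01 ih01 icst; apply.
  - exact: lebesgue_pt_integral_le.
have uP N := kernel_coordsP N mu01_lty x.
pose k N := toeplitz_sqnorm mu (kernel_coords mu N x).
have uE : (fun N : nat => (N.+1%:R / modified_kernel (fourier_coef mu) N
    (expi (2 * pi * x)) (expi (2 * pi * x)) - 1) : R[i]^o) =
    (fun N => (N.+1%:R / k N - 1)%:C : R[i]^o).
  apply/funext => N; have [k0 -> _ _] := uP N.
  by rewrite rmorphB rmorphM fmorphV/= rmorph_nat.
rewrite uE; apply: cvg_realc => e e0.
pose w := 1 + h x.
have w1 : 1 <= w by rewrite lerDl.
pose e' := e / (3 + w ^+ 2).
have c0 : 0 < 3 + w ^+ 2 by rewrite ltr_pwDl// sqr_ge0.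
have e'0 : 0 < e' by rewrite divr_gt0.
near=> N.
have [k0 _ uPsi nk] := uP N.
have -> : h x - (N.+1%:R / k N - 1) = w - N.+1%:R / k N by rewrite /w; ring.
rewrite (_ : e = (3 + w ^+ 2) * e'); last by rewrite /e' mulrC divfK// gt_eqF.
have hN : (\int[@lebesgue_measure R]_(t in `[0%R, 1%R])
    (fejer x N t * `|h t - h x|)%:E <= e'%:E)%E by near: N; exact: h_cvg.
have atN : (\int[mu_at]_(t in `[0%R, 1%R]) (fejer x N t)%:E <= e'%:E)%E.
  by near: N; exact: sing_cvg.
have scN : (\int[mu_sc]_(t in `[0%R, 1%R]) (fejer x N t)%:E <= e'%:E)%E.
  by near: N; exact: sing_cvg.
have mF : measurable_fun setT (fejer x N).
  by apply: continuous_measurable_fun; exact: continuous_fejer.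
have mhx : measurable_fun setT (fun t => `|h t - h x|).
  by apply: measurableT_comp => //; exact: measurable_funB.
have iF : mu.-integrable `[0, 1] (EFin \o fejer x N).
  by apply: continuous_integrable01 => //; exact: continuous_fejer.
apply: mean_bounds_dist_le => //.
- by rewrite divr_gt0.
- exact: ltW.
- have muF : \int[mu]_(t in `[0, 1]) fejer x N t <= h x + 3 * e'.
    rewrite -lee_fin /Rintegral fineK; last exact: integrable_fin_num.
    rewrite mu_integral//; last by move=> t; exact: fejer_ge0.
    rewrite (_ : h x + 3 * e' = e' + (h x + e') + e'); last ring.
    rewrite !EFinD leeD// leeD// -EFinD hE//; last by move=> t; exact: fejer_ge0.
    apply: (@integral_fejerD_le _ (fun t => `|h t - h x|)) => //.
    by move=> t; rewrite -lerBlDl ler_norm.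
  (* With n = N + 1, the squared norm of psi is n times 1 plus the Fejer mean of [mu];
     Cauchy-Schwarz then bounds n / k by that sum. *)
  rewrite ler_pdivrMr//; move: nk; rewrite expr2 /toeplitz_sqnorm.
  rewrite sum_sqnormc_monomials.
  under eq_Rintegral do rewrite trigp_monomials.
  rewrite RintegralZr// => nk'.
  have n0 : 0 < N.+1%:R :> R by rewrite ltr0n.
  rewrite -(ler_pM2l n0); apply: le_trans nk' _.
  rewrite -[X in (_ + X) * _]mul1r -mulrDl mulrAC mulrC ler_pM2l//.
  by rewrite ler_pM2r// addrC -addrA lerD2l.
(* The lower bound in inverted form: k / n is at most the Fejer mean of 1 / (1 + h), which exceeds 1
   / w by at most [e']. *)
- rewrite invf_div -lee_fin.
  apply: le_trans (kernel_le_fejer_mean mu01_lty h0 mh _ uPsi) _.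
    move=> f f0 mf; rewrite -hE// mu_integral//.
    rewrite [(_ + \int[mu_ac]_(_ in _) _)%E]addeC -addeA leeDl//.
    by rewrite adde_ge0// integral_ge0// => t _; rewrite lee_fin.
  apply: (@integral_fejerD_le _ (fun t => `|h t - h x|)) => //.
  + by rewrite invr_ge0 ltW// (lt_le_trans _ w1).
  + exact: measurable_inv1D.
  + by move=> t; rewrite invr_ge0 addr_ge0.
  + by move=> t; exact: inv1D_dist_le.
Unshelve. all: by end_near.
Qed.
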